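(* Let $\alpha>0$, $\beta>0$, $c\in\mathbb{R}\setminus\{0\}$. Let $\xi\in Stacy(\alpha,\beta;c)$ and let $\tau$ be a random variable such that for every $\lambda>0$ the conditional distribution of $\tau$ given $\xi=\lambda$ is $Exp(\lambda)$. Then: (a) $\tau\in Exp\text{-}St(\alpha,\beta;c)$. (b) If $k>0$ is a constant, then $k\tau\in Exp\text{-}St(\alpha,k\beta;c)$. (c) $\tau\stackrel{d}{=}\frac{\eta}{\xi}$, where $\eta\in Exp(1)$, and $\xi$ and $\eta$ are independent. (d) For all real $z\ge -1$ with $\frac{z}{c}\le\alpha$, $$\mathbb{E}(\tau^z)=\frac{\Gamma(z+1)\beta^z}{\Gamma(\alpha)}\Gamma\left(\alpha-\frac{z}{c}\right),$$ and, if $\max\left(\frac{2}{c},\frac{1}{c}\right)\le\alpha$, the variance of $\tau$ is $$\mathbb{D}\tau=\frac{\beta^2}{\Gamma(\alpha)}\left(2\Gamma\left(\alpha-\frac{2}{c}\right)-\frac{1}{\Gamma(\alpha)}\Gamma^2\left(\alpha-\frac{1}{c}\right)\right).$$ (e) The joint distribution of $\tau$ and $\xi$ is $(\tau,\xi)\in Exp\text{-}Stacy\text{-}I(\alpha,\beta;c)$, and $(\tau,\xi)\stackrel{d}{=}\left(\frac{\eta}{\xi},\xi\right)$, where $\eta\in Exp(1)$, and $\xi$ and $\eta$ are independent. (f) For all $t>0$, the conditional density of $\xi$ given $\tau=t$ is $$P_\xi(x\,|\,\tau=t)=x^{c\alpha}e^{-tx-(\beta x)^c}\frac{\beta^{c\alpha+1}}{Z_{-c}^{-c\alpha-1}\left(\frac{t}{\beta}\right)},\quad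 x>0,$$ and $P_\xi(x\,|\,\tau=t)=0$ when $x\le 0$. (g) $\mathbb{E}(\tau\,|\,\xi=x)=\frac1x$ for $x>0$. (h) $$\mathbb{E}(\xi\,|\,\tau=t)=\frac{Z_{-c}^{-c\alpha-2}\left(\frac{t}{\beta}\right)}{\beta Z_{-c}^{-c\alpha-1}\left(\frac{t}{\beta}\right)},\quad t>0.$$
   Context: $\Gamma(\alpha)=\int_0^\infty y^{\alpha-1}e^{-y}\,dy$, with the convention $\Gamma(0)=+\infty$; expectations of nonnegative random variables (and variances) are allowed to be $+\infty$. $\mathbb{D}$ denotes variance, and $\stackrel{d}{=}$ denotes equality in distribution. $\xi\in Stacy(\alpha,\beta;c)$ means that $\xi$ is a positive random variable with probability density function $$P_\xi(x)=|c|\frac{\beta^{c\alpha}}{\Gamma(\alpha)}x^{c\alpha-1}e^{-(\beta x)^c},\quad x>0,$$ and $P_\xi(x)=0$ for $x\le0$. $Exp(\lambda)$, $\lambda>0$, is the exponential distribution with density $\lambda e^{-\lambda t}$, $t>0$ (mean $1/\lambda$). The Krätzel function is $$Z_\rho^\nu(x)=\int_0^\infty y^{\nu-1}e^{-(y^\rho+\frac{x}{y})}\,dy=\int_0^\infty t^{-\nu-1}e^{-(t^{-\rho}+tx)}\,dt,\quad x>0,$$ for $\rho>0$ and any $\nu$, and, when $\rho\le0$, for $\mathrm{Re}(\nu)<0$. $\tau\in Exp\text{-}St(\alpha,\beta;c)$ (Exp-Stacy distribution) means that $\tau$ has density $$P_\tau(t)=\frac{|c|}{\beta\Gamma(\alpha)}Z_{-c}^{-c\alpha-1}\left(\frac{t}{\beta}\right)\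 \text{ for } t>0,\qquad P_\tau(t)=0\ \text{ for } t\le0.$$ $(\tau,\xi)\in Exp\text{-}Stacy\text{-}I(\alpha,\beta;c)$ (bivariate Exp-Stacy distribution of the first kind) means that $(\tau,\xi)$ has joint density $$P_{\tau,\xi}(t,x)=|c|\,x\,\frac{\beta^{c\alpha}}{\Gamma(\alpha)}x^{c\alpha-1}e^{-(\beta x)^c-tx}\ \text{ for } t>0,\ x>0,$$ and $0$ otherwise. *)

(* Defs.v *)
From HB Require Import structures.
From mathcomp Require Import all_boot all_order all_algebra.
From mathcomp Require Import all_classical all_reals all_analysis measurable_realfun.
Set Implicit Arguments.
Unset Strict Implicit.
Unset Printing Implicit Defensive.
Import Order.TTheory GRing.Theory Num.Theory.
Import numFieldNormedType.Exports.
Local Open Scope classical_set_scope.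
Local Open Scope ring_scope.

Section special_functions.
Context {R : realType}.
Local Notation mu := (@lebesgue_measure R).

(* Extended-real valued, so that the convention Gamma 0 = +oo is the value of
   the (divergent) Lebesgue integral itself.  For alpha > 0 the integral is
   finite, and the real number Gamma(alpha) is fine (Gamma alpha). *)
Definition Gamma (a : R) : \bar R :=
  (\int[mu]_(y in `]0%R, +oo[) (y `^ (a - 1) * expR (- y))%:E)%E.

Lemma Gamma0 : Gamma 0 = +oo%E.
Proof.
apply/eqyP => M M0.
have [e e01 eM] : exists2 e : R, 0 < e < 1 & M <= expR (- 1) * (- ln e).
  exists (expR (- (M * expR 1))).
    by rewrite expR_gt0 expR_lt1 oppr_lt0 mulr_gt0// expR_gt0.
  by rewrite expRK opprK mulrCA -expRD addNr expR0 mulr1.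
have {e01}[e0 e1] := andP e01.
have De (x : R) : x \in `[e, 1] -> 0 < x.
  by rewrite in_itv/= => /andP[+ _]; exact: lt_le_trans.
have cinv : {within `[e, 1], continuous (fun x : R => x^-1)}.
  apply: continuous_in_subspaceT => x /[!inE]/= /De x0.
  by apply: inv_continuous; rewrite gt_eqF.
have FTC : (\int[mu]_(x in `[e, 1%R]) (x^-1)%:E = (ln 1)%:E - (ln e)%:E)%E.
  apply: continuous_FTC2 => //.
  - split.
    + move=> x; rewrite in_itv/= => /andP[ex _].
      by have [] := is_derive1_ln (lt_trans e0 ex).
    + by apply: cvg_at_right_filter; exact: continuous_ln.
    + by apply: cvg_at_left_filter; exact: continuous_ln.
  - move=> x; rewrite in_itv/= => /andP[ex _].
    by rewrite derive1E; have [_ ->] := is_derive1_ln (lt_trans e0 ex).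
have mf : measurable_fun `[e, 1] (fun y : R => y^-1).
  apply: (measurable_funS (measurable_itv `]0, +oo[)) => //.
    by move=> x /= /De x0; rewrite in_itv/= x0.
  apply: open_continuous_measurable_fun; first exact: interval_open.
  move=> x /[!inE]/=; rewrite in_itv/= andbT => x0.
  by apply: inv_continuous; rewrite gt_eqF.
apply: (@le_trans _ _ (\int[mu]_(y in `[e, 1%R]) ((expR (- 1))%:E * (y^-1)%:E))%E).
  rewrite ge0_integralZl//=.
  - by rewrite FTC ln1 sub0e -EFinN -EFinM lee_fin.
  - exact/measurable_EFinP.
  - by move=> x /De x0; rewrite lee_fin invr_ge0 ltW.
have mG : measurable_fun [set: R] (fun y : R => y `^ (0 - 1) * expR (- y)).
  apply: measurable_funM; first exact: measurable_powR.
  by apply: measurableT_comp => //; exact: measurable_funN.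
apply: (@le_trans _ _
    (\int[mu]_(y in `[e, 1%R]) (y `^ (0 - 1) * expR (- y))%:E)%E).
  apply: ge0_le_integral => //=.
  - by move=> x /De x0; rewrite -EFinM lee_fin mulr_ge0 ?expR_ge0// invr_ge0 ltW.
  - by apply/measurable_EFinP; exact: measurable_funM.
  - by apply/measurable_EFinP; exact: measurable_funTS.
  - move=> x x1; have x0 := De _ x1.
    rewrite -EFinM lee_fin sub0r (powR_inv1 (ltW x0)) mulrC.
    rewrite ler_pM2l ?invr_gt0//.
    by rewrite ler_expR lerN2; move: x1; rewrite in_itv/= => /andP[].
apply: ge0_subset_integral => //=.
- by apply/measurable_EFinP; exact: measurable_funTS.
- by move=> x _; rewrite lee_fin mulr_ge0 ?powR_ge0 ?expR_ge0.
- by move=> x /= /De x0; rewrite in_itv/= andbT.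
Qed.

(* Meaningful (i.e., convergent) for x > 0 when rho > 0, or when rho <= 0 and
   nu < 0; only real nu are considered. *)
Definition kratzel (rho nu x : R) : R :=
  \int[mu]_(y in `]0%R, +oo[) (y `^ (nu - 1) * expR (- (y `^ rho + x / y))).

Definition stacy_pdf (alpha beta c x : R) : R :=
  if 0 < x then
    `|c| * (beta `^ (c * alpha) / fine (Gamma alpha)) *
      x `^ (c * alpha - 1) * expR (- ((beta * x) `^ c))
  else 0.

Definition exp_st_pdf (alpha beta c t : R) : R :=
  if 0 < t then
    `|c| / (beta * fine (Gamma alpha)) *
      kratzel (- c) (- (c * alpha) - 1) (t / beta)
  else 0.

Definition exp_stacy1_pdf (alpha beta c : R) (p : R * R) : R :=
  let: (t, x) := p in
  if (0 < t) && (0 < x) then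
    `|c| * x * (beta `^ (c * alpha) / fine (Gamma alpha)) *
      x `^ (c * alpha - 1) * expR (- ((beta * x) `^ c) - t * x)
  else 0.

Definition stacy_cond_pdf (alpha beta c t x : R) : R :=
  if 0 < x then
    x `^ (c * alpha) * expR (- (t * x) - (beta * x) `^ c) *
      (beta `^ (c * alpha + 1) /
        kratzel (- c) (- (c * alpha) - 1) (t / beta))
  else 0.

End special_functions.
Arguments Gamma {R} a%_R.

Section laws.
Context {R : realType}.

Definition density_of d (T : measurableType d) (mu : {measure set T -> \bar R})
    (Q : set T -> \bar R) (f : T -> R) : Prop :=
  [/\ forall x, 0 <= f x, measurable_fun [set: T] f &
      forall A, measurable A -> Q A = (\int[mu]_(x in A) (f x)%:E)%E].

Context d {T : measurableType d} (P : probability T R).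

Definition eq_dist d' (U : measurableType d') (X Y : T -> U) : Prop :=
  forall A, measurable A -> pushforward P X A = pushforward P Y A.

Definition independent_RV d1 (U1 : measurableType d1) d2
    (U2 : measurableType d2) (X : T -> U1) (Y : T -> U2) : Prop :=
  forall A B, measurable A -> measurable B ->
    P (X @^-1` A `&` Y @^-1` B) = (P (X @^-1` A) * P (Y @^-1` B))%E.

Definition is_exp (X : T -> R) (lambda : R) : Prop :=
  forall A, measurable A -> pushforward P X A = exponential_prob lambda A.

(* almost sure positivity of X is enforced by the density *)
Definition is_stacy (X : T -> R) (alpha beta c : R) : Prop :=
  density_of (@lebesgue_measure R) (pushforward P X) (stacy_pdf alpha beta c).

Definition is_exp_st (X : T -> R) (alpha beta c : R) : Prop :=
  density_of (@lebesgue_measure R) (pushforward P X) (exp_st_pdf alpha beta c).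

Definition is_exp_stacy1 (X : T -> R * R) (alpha beta c : R) : Prop :=
  density_of (@lebesgue_measure R \x @lebesgue_measure R)%E
    (pushforward P X) (exp_stacy1_pdf alpha beta c).

(* The probability kernel k is a regular conditional distribution of Y given X:
   k x is the conditional distribution of Y given X = x. *)
Definition cond_distribution d1 (U1 : measurableType d1) d2
    (U2 : measurableType d2) (Y : {RV P >-> U2}) (X : {RV P >-> U1})
    (k : R.-pker U1 ~> U2) : Prop :=
  forall A B, measurable A -> measurable B ->
    P (X @^-1` A `&` Y @^-1` B) = (\int[distribution P X]_(x in A) k x B)%E.

End laws.

(* E(Y | X = x), for k the conditional distribution of Y given X *)
Definition cond_expectation {R : realType} d (U : measurableType d)
    (k : R.-pker U ~> R) (x : U) : \bar R :=
  (\int[k x]_y y%:E)%E.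

(* Main.v *)
Require Import Defs.
From HB Require Import structures.
From mathcomp Require Import all_boot all_order all_algebra.
From mathcomp Require Import all_classical all_reals all_analysis measurable_realfun.
From mathcomp Require Import ring lra.
Set Implicit Arguments.
Unset Strict Implicit.
Unset Printing Implicit Defensive.
Import Order.TTheory GRing.Theory Num.Theory.
Import numFieldNormedType.Exports.
Local Open Scope classical_set_scope.
Local Open Scope ring_scope.

Local Notation pushforward_measure :=
  measure_function_pushforward__canonical__measure_function_Measure.

(** Given xi = lambda the time tau is exponential with rate lambda, so the pair
(tau, xi) has on the positive quadrant the joint density
s(x) * x * exp(- t x), where s is the Stacy density.  All the claims are read
off this joint law.

The events that define a conditional law are rectangles; since rectangles
determine a finite measure on a product, the joint density follows
([conditionally_exponential_joint]).  Integrating out x gives the density of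
tau ([exp_stacy1_marginal]), which is a Krätzel function after the
substitution y = 1 / (beta x) ([kratzelE]); dividing by it gives the conditional
density of xi given tau = t, hence a kernel and its mean
([exp_stacy1_conditional]).  Integrating out t first, with the change of
variable y = t x, turns the inner exponential law of rate x into the one of
rate 1: hence tau * xi is an Exp(1) variable independent of xi
([exp_stacy1_product]), and conversely eta / xi has with xi the same joint
density as tau ([exp_stacy1_quotient]).  The same computation with the weight
t^z gives
E (tau^z) = Gamma (z + 1) * E (xi^-z), where the second factor is again a
Gamma integral after the substitution y = (beta x)^c ([exp_st_moment]).

The variables are almost surely positive and all the integrands are
nonnegative on the half-line, so the computations take place in the extended
reals, where Tonelli's theorem and the substitutions need no integrability; the
infinite values in the moments and in the variance come out with the rest.
Every substitution on the half-line is an instance of y = (b x)^c for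
measurable functions ([ge0_integral_powR]); after y = exp (- u) it becomes an
affine change of variable on the line. *)

(** * Densities and product measures *)

Section densities.
Local Open Scope ereal_scope.
Context d (T : measurableType d) (R : realType).
Variable mu : {measure set T -> \bar R}.

(** The term carries the proofs of nonnegativity and measurability so that its
measure structure can be inferred. *)
Definition measure_of_density (f : T -> \bar R) (f0 : forall x, 0 <= f x)
    (mf : measurable_fun [set: T] f) (A : set T) : \bar R :=
  \int[mu]_(x in A) f x.

Section measure_of_density.
Variables (f : T -> \bar R) (f0 : forall x, 0 <= f x)
  (mf : measurable_fun [set: T] f).
Local Notation nu := (measure_of_density f0 mf).

Let nu0 : nu set0 = 0.
Proof. exact: integral_set0. Qed.

Let nu_ge0 A : 0 <= nu A.
Proof. exact: integral_ge0. Qed.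

Let nu_sigma_additive : semi_sigma_additive nu.
Proof. exact: semi_sigma_additive_nng_induced. Qed.

HB.instance Definition _ := isMeasure.Build _ _ _ nu
  nu0 nu_ge0 nu_sigma_additive.

End measure_of_density.

Import HBNNSimple.

(** By definition of a density the identity holds for indicators, hence for
simple functions; monotone convergence extends it to all nonnegative ones. *)
Lemma ge0_integral_density (nu : {measure set T -> \bar R}) (f : T -> R)
    (g : T -> \bar R) :
  density_of mu nu f -> (forall x, 0 <= g x) -> measurable_fun [set: T] g ->
  \int[nu]_x g x = \int[mu]_x (g x * (f x)%:E).
Proof.
move=> [f0 mf nuE] g0 mg.
have mfE : measurable_fun [set: T] (EFin \o f) by exact/measurable_EFinP.
pose h := nnsfun_approx measurableT mg.
have gE x : g x = limn (fun n => (h n x)%:E).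
  by apply/esym/cvg_lim => //; exact: cvg_nnsfun_approx.
transitivity (limn (fun n => \int[nu]_x (h n x)%:E)).
  under eq_integral do rewrite gE.
  apply: monotone_convergence => //.
  - by move=> n; exact/measurable_EFinP.
  - by move=> n x _; rewrite lee_fin.
  - by move=> x _ a b ab; rewrite lee_fin; exact/lefP/nd_nnsfun_approx.
transitivity (limn (fun n => \int[mu]_x ((h n x)%:E * (f x)%:E))); last first.
  rewrite -monotone_convergence//.
  - apply: eq_integral => x _; rewrite gE; apply/cvg_lim => //.
    apply: cvgeZr => //; rewrite -gE.
    exact: cvg_nnsfun_approx.
  - by move=> n; apply: emeasurable_funM => //; exact/measurable_EFinP.
  - by move=> n x _; rewrite mule_ge0// lee_fin.
  - move=> x _ a b ab; rewrite lee_wpmul2r ?lee_fin//.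
    exact/lefP/nd_nnsfun_approx.
congr (limn _); apply/funext => n.
rewrite integralT_nnsfun sintegralE.
under [RHS]eq_integral.
  move=> x _; rewrite (fimfunE (h n) x) -fsumEFin// ge0_mule_fsuml; last first.
    by move=> r; exact: nnfun_muleindic_ge0.
  over.
rewrite ge0_integral_fsum//; last 2 first.
- move=> r; apply: emeasurable_funM => //.
  by apply/measurable_EFinP; exact: measurable_funM.
- by move=> r x _; rewrite mule_ge0 ?nnfun_muleindic_ge0// lee_fin.
apply: eq_fsbigr => r; rewrite inE => -[t _ <-].
under eq_integral do rewrite EFinM -muleA.
rewrite ge0_integralZl//; last 3 first.
- by apply: emeasurable_funM => //; exact/measurable_EFinP.
- by move=> x _; rewrite mule_ge0// lee_fin.
- by rewrite lee_fin.
congr (_ * _).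
rewrite nuE// [LHS]integral_mkcond; apply: eq_integral => x _.
by rewrite epatch_indic/= muleC.
Qed.

End densities.

(** Measurable rectangles are stable under intersection and generate the product
sigma-algebra. *)
Lemma measure_rect_unique d1 d2 (T1 : measurableType d1) (T2 : measurableType d2)
    (R : realType) (m1 m2 : {measure set (T1 * T2) -> \bar R}) :
  (m1 setT < +oo)%E ->
  (forall A B, measurable A -> measurable B -> m1 (A `*` B) = m2 (A `*` B)) ->
  forall C, measurable C -> m1 C = m2 C.
Proof.
move=> m1oo m12 C mC.
apply: (measure_unique [set A `*` B | A in measurable & B in measurable]
  (fun=> setT)) => //.
- exact: measurable_prod_measurableType.
- move=> _ _ [X1 mX1 [X2 mX2 <-]] [Y1 mY1 [Y2 mY2 <-]].
  exists (X1 `&` Y1); first exact: measurableI.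
  by exists (X2 `&` Y2); [exact: measurableI|rewrite setXI].
- by move=> _; exists setT => //; exists setT => //; rewrite setXTT.
- by rewrite bigcup_const//; exists 0%N.
- by move=> _ [A mA [B mB <-]]; exact: m12.
Qed.

(** * Change of variables on the half-line *)

Section change_of_variables.
Local Open Scope ereal_scope.
Context {R : realType}.
Local Notation mu := (@lebesgue_measure R).
Implicit Types f : R -> \bar R.

(** Lebesgue measure is determined by its values on the intervals ]x, y], whose
preimages under an affine map are intervals of length divided by |a|. *)
Lemma ge0_integral_affine f (a b : R) : (a != 0)%R ->
  measurable_fun [set: R] f -> (forall y, 0 <= f y) ->
  \int[mu]_y f y = \int[mu]_u (f (a * u + b)%R * `|a|%:E).
Proof.
move=> a0 mf f0.
have mphi : measurable_fun [set: measurableTypeR R]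
    (fun u : R => (a * u + b)%R : measurableTypeR R).
  by apply: measurable_funD => //; exact: measurable_funM.
pose m := mscale (NngNum (normr_ge0 a)) (pushforward_measure mu mphi).
have muE A : measurable A -> mu A = m A.
  apply: lebesgue_measure_unique => _ [[x y] _ <-].
  rewrite /m/= /mscale/= /pushforward.
  have [ap|an] := ltP 0%R a.
    rewrite (_ : _ @^-1` _ = `](x - b) / a, (y - b) / a]%classic)%R; last first.
      apply/seteqP; split => u /=; rewrite !in_itv/=.
        by rewrite ler_pdivlMr// ltr_pdivrMr// mulrC ltrBlDr lerBrDr.
      by rewrite ler_pdivlMr// ltr_pdivrMr// mulrC ltrBlDr lerBrDr.
    rewrite !lebesgue_measure_itv/= !lte_fin ltr_pM2r ?invr_gt0// ltrD2r.
    case: ifPn => xy; last by rewrite mule0.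
    by rewrite -!EFinD -EFinM gtr0_norm//; congr EFin; field.
  have {}an : (a < 0)%R by rewrite lt_neqAle a0.
  rewrite (_ : _ @^-1` _ = `[(y - b) / a, (x - b) / a[%classic)%R; last first.
    apply/seteqP; split => u /=; rewrite !in_itv/=.
      by rewrite ler_ndivrMr// ltr_ndivlMr// mulrC ltrBlDr lerBrDr andbC.
    by rewrite ler_ndivrMr// ltr_ndivlMr// mulrC ltrBlDr lerBrDr andbC.
  rewrite !lebesgue_measure_itv/= !lte_fin ltr_nM2r ?invr_lt0// ltrD2r.
  case: ifPn => xy; last by rewrite mule0.
  by rewrite -!EFinD -EFinM ltr0_norm//; congr EFin; field.
transitivity (\int[m]_y f y).
  by apply: eq_measure_integral => A mA _; exact: muE.
rewrite ge0_integral_mscale//= ge0_integral_pushforward//= preimage_setT.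
by rewrite muleC -ge0_integralZr//; exact: measurableT_comp.
Qed.

Lemma integral_mul_indic (D : set R) f :
  \int[mu]_(x in D) f x = \int[mu]_x (f x * (\1_D x)%:E).
Proof. by rewrite integral_mkcond epatch_indic. Qed.

Lemma integral_expRN_ray (x : R) :
  \int[mu]_(u in `[x, +oo[) (expR (- u))%:E = (expR (- x))%:E.
Proof.
rewrite (@ge0_continuous_FTC2y R (fun u : R => expR (- u))
  (fun u => - expR (- u))%R x 0%R)//.
- by rewrite EFinN oppeK add0e.
- apply: continuous_subspaceT => u.
  by apply: continuous_comp; [exact: opp_continuous|exact: continuous_expR].
- by rewrite -oppr0; apply: cvgN; exact: cvgr_expR.
- apply: cvgN; apply: cvg_at_right_filter.
  by apply: continuous_comp; [exact: opp_continuous|exact: continuous_expR].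
- by move=> u _; rewrite derive1E derive_val; ring.
Qed.

(** Both sides are integrals of u |-> f (exp (- u)), against the image of Lebesgue
measure on the half-line under - ln on one side, against the density exp (- u)
on the other.  The two measures give the finite mass exp (- x) to each ray
[x, +oo[, and these rays generate the Borel sets.  The sign in exp (- u) is what
makes the generating rays have finite mass. *)
Lemma ge0_integral_expRN f : measurable_fun [set: R] f -> (forall y, 0 <= f y) ->
  \int[mu]_(y in `]0%R, +oo[) f y = \int[mu]_u (f (expR (- u)) * (expR (- u))%:E).
Proof.
move=> mf f0.
have mD : measurable_fun [set: R] (\1_`]0%R, +oo[ : R -> R).
  exact: measurable_indic.
have mDE : measurable_fun [set: R] (EFin \o (\1_`]0%R, +oo[ : R -> R)).
  exact/measurable_EFinP.
have D0E (x : R) : 0 <= (EFin \o (\1_`]0%R, +oo[ : R -> R)) x by rewrite lee_fin.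
have e0 (x : R) : 0 <= (EFin \o (fun u => expR (- u))) x.
  by rewrite lee_fin expR_ge0.
have me : measurable_fun [set: R] (fun u : R => expR (- u)).
  by apply: measurableT_comp => //; exact: measurable_funN.
have meE : measurable_fun [set: R] (EFin \o (fun u => expR (- u))).
  exact/measurable_EFinP.
have mphi : measurable_fun [set: measurableTypeR R]
    (fun y : R => (- ln y)%R : measurableTypeR R).
  by apply: measurable_funN; exact: measurable_ln.
pose m1 := pushforward_measure (measure_of_density mu D0E mDE) mphi.
pose m2 := measure_of_density mu e0 meE.
have ray x : m1 `[x, +oo[%classic = (expR (- x))%:E.
  have mpre : measurable ((fun y : R => - ln y)%R @^-1` `[x, +oo[%classic).
    by rewrite -[X in measurable X]setTI; apply: (mphi) => //; exact: measurable_itv.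
  rewrite /m1/= /pushforward /measure_of_density/= integral_indic//.
  rewrite (_ : _ `&` _ = `]0%R, expR (- x)]%classic).
    transitivity (mu `]0%R, expR (- x)]%classic) => //.
    by rewrite lebesgue_measure_itv/= lte_fin expR_gt0 oppr0 adde0.
  apply/seteqP; split => [y /=[]|y /=].
    rewrite !in_itv/= !andbT => y0 xy; rewrite y0/=.
    by rewrite -[y]lnK ?posrE// ler_expR lerNr.
  rewrite !in_itv/= !andbT => /andP[y0 xy]; split => //.
  by rewrite lerNr -[leRHS]expRK ler_ln ?posrE ?expR_gt0.
have m12 (A : set (measurableTypeR R)) : measurable A -> m1 A = m2 A.
  refine (@measure_unique _ R (measurableTypeR R) (@RGenCInfty.G R)
    (fun n => `[(- n%:R)%R, +oo[%classic) _ _ _ _ m1 m2 _ _ A).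
  - exact: RGenCInfty.measurableE.
  - move=> _ _ [x ->] [y ->]; exists (Num.max x y).
    by apply/seteqP; split => z /=; rewrite !in_itv/= !andbT ge_max;
      [move=> [-> ->]|move=> /andP[]].
  - by move=> n; exists (- n%:R)%R.
  - apply/seteqP; split => // x _.
    exists (Num.truncn `|x|).+1 => //=; rewrite in_itv/= andbT lerNl.
    by rewrite (le_trans (ler_norm _))// normrN ltW// truncnS_gt.
  - by move=> _ [x ->]; rewrite ray; exact/esym/integral_expRN_ray.
  - by move=> n; rewrite [X in X < _]ray ltry.
transitivity (\int[m1]_u f (expR (- u))).
  rewrite ge0_integral_pushforward//=; last first.
    by apply: measurableT_comp.
  rewrite preimage_setT (@ge0_integral_density _ _ _ mu _ (\1_`]0%R, +oo[))//.
  - rewrite integral_mul_indic; apply: eq_integral => y _.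
    rewrite !indicE mem_setE/= in_itv/= andbT; case: ltP => [y0|]; last by rewrite !mule0.
    by rewrite opprK lnK.
  - by do 3 apply: measurableT_comp => //; exact: measurable_funN.
transitivity (\int[m2]_u f (expR (- u))).
  by apply: eq_measure_integral => A mA _; exact: m12.
rewrite (@ge0_integral_density _ _ _ mu _ (fun u => expR (- u)))//.
by apply: measurableT_comp.
Qed.

End change_of_variables.

(** Off zero the inverse is the power of exponent -1, up to sign, and both take
the value 0 at 0. *)
Lemma measurable_funV {R : realType} :
  measurable_fun [set: R] (fun x : R => x^-1).
Proof.
apply: (eq_measurable_fun
    (fun x : R => if 0 <= x then x `^ (-1) else - (- x) `^ (-1))) => [x _|].
  case: leP => x0; first by rewrite powR_inv1.
  by rewrite powR_inv1 ?oppr_ge0 1?ltW// invrN opprK.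
apply: measurable_fun_ifT => //; first exact: measurable_fun_ler.
apply: measurable_funN; apply: (measurableT_comp (measurable_powR (-1))).
exact: measurable_funN.
Qed.

Section power_substitution.
Local Open Scope ereal_scope.
Context {R : realType}.
Local Notation mu := (@lebesgue_measure R).
Implicit Types f : R -> \bar R.

Lemma gt0_powRE (x p : R) : (0 < x -> x `^ p = expR (p * ln x))%R.
Proof. by move=> x0; rewrite /powR gt_eqF. Qed.

Lemma half_lineE (x : R) : (x \in (`]0%R, +oo[%classic : set R)) = (0 < x)%R.
Proof. by rewrite mem_setE/= in_itv/= andbT. Qed.

Lemma eq_integral_half_line f (g : R -> \bar R) :
  (forall x, (0 < x)%R -> f x = g x) ->
  \int[mu]_(x in `]0%R, +oo[) f x = \int[mu]_(x in `]0%R, +oo[) g x.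
Proof. by move=> fg; apply: eq_integral => x; rewrite half_lineE => /fg. Qed.

(** With y = exp (- v) on the left and x = exp (- u) on the right, the relation
y = (b x)^c reads v = c u - c ln b, which is affine. *)
Lemma ge0_integral_powR f (b c : R) : (0 < b)%R -> (c != 0)%R ->
  measurable_fun [set: R] f -> (forall y, 0 <= f y) ->
  \int[mu]_(y in `]0%R, +oo[) f y =
  \int[mu]_(x in `]0%R, +oo[) (f ((b * x) `^ c)%R *
    (`|c| * b `^ c * x `^ (c - 1))%R%:E).
Proof.
move=> b0 c0 mf f0.
have mexpN : measurable_fun [set: R] (fun u : R => expR (- u)).
  by apply: measurableT_comp => //; exact: measurable_funN.
have mpow p : measurable_fun [set: R] (fun x : R => (b * x) `^ p)%R.
  by apply: (measurableT_comp (measurable_powR p)); exact: measurable_funM.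
rewrite ge0_integral_expRN// (@ge0_integral_affine _ _ c (- (c * ln b)))//; last 2 first.
- by apply: emeasurable_funM; [exact: measurableT_comp|exact/measurable_EFinP].
- by move=> u; rewrite mule_ge0// lee_fin expR_ge0.
rewrite ge0_integral_expRN; last 2 first.
- apply: emeasurable_funM; first exact: measurableT_comp.
  by apply/measurable_EFinP; exact: measurable_funM.
- by move=> x; rewrite mule_ge0// lee_fin !mulr_ge0// powR_ge0.
apply: eq_integral => u _.
rewrite !gt0_powRE ?mulr_gt0 ?expR_gt0// lnM ?posrE ?expR_gt0// expRK.
rewrite -!muleA; congr (f (expR _) * _); first by ring.
rewrite -!EFinM; congr EFin.
rewrite [LHS]mulrC -!mulrA -!expRD; congr (_ * expR _)%R; ring.
Qed.

Lemma ge0_integral_scale f (b : R) : (0 < b)%R ->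
  measurable_fun [set: R] f -> (forall y, 0 <= f y) ->
  \int[mu]_(y in `]0%R, +oo[) f y =
  \int[mu]_(x in `]0%R, +oo[) (f (b * x)%R * b%:E).
Proof.
move=> b0 mf f0; rewrite (@ge0_integral_powR f b 1)//.
apply: eq_integral_half_line => x x0.
by rewrite !powRr1 ?mulr_ge0 ?ltW// subrr powRr0 normr1 mul1r mulr1.
Qed.

(** A nonnegative function of integral 0 vanishes almost everywhere, but the
half-line has positive measure. *)
Lemma integral_half_line_gt0 f : measurable_fun [set: R] f ->
  (forall x, (0 < x)%R -> 0 < f x) -> 0 < \int[mu]_(x in `]0%R, +oo[) f x.
Proof.
move=> mf f0.
have f0' x : (`]0%R, +oo[%classic : set R) x -> 0 <= f x.
  by rewrite /= in_itv/= andbT => /f0/ltW.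
rewrite lt_neqAle integral_ge0// andbT eq_sym; apply/eqP => If0.
suff /ae_eq_integral_abs : \int[mu]_(x in `]0%R, +oo[) `|f x| = 0.
  have mfD : measurable_fun (`]0%R, +oo[%classic : set R) f by exact: measurable_funTS.
  move=> /(_ (measurable_itv _) mfD) [N [mN N0 sN]].
  have : mu (`]0%R, +oo[%classic : set R) <= mu N.
    apply: le_measure; rewrite ?inE// => x /= x0; apply: sN => /= /(_ x0)/eqP.
    by rewrite gt_eqF// f0//; move: x0; rewrite in_itv/= andbT.
  by rewrite N0 lebesgue_measure_itv/= ltry/= leNgt ltry.
rewrite -If0; apply: eq_integral_half_line => x x0.
by rewrite gee0_abs// ltW// f0.
Qed.

(** The maximum of x^p exp (- t x) is at x = p / t; the bound, which drops a factor
exp (- p), is ln u <= u - 1 at u = x t / p. *)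
Lemma powR_expRN_le (p t x : R) : (0 < p)%R -> (0 < t)%R -> (0 < x)%R ->
  (x `^ p * expR (- (t * x)) <= (p / t) `^ p)%R.
Proof.
move=> p0 t0 x0.
have pt0 : (0 < p / t)%R by rewrite divr_gt0.
rewrite !gt0_powRE// -expRD ler_expR.
have : (ln (x / (p / t)) <= x / (p / t) - 1)%R.
  rewrite -[X in ln X](_ : 1 + (x / (p / t) - 1) = _)%R; last by ring.
  by apply: le_ln1Dx; rewrite ltrBDr addNr divr_gt0.
rewrite ln_div ?posrE// => lnx.
have : (p * (ln x - ln (p / t)) <= p * (x / (p / t) - 1))%R by rewrite ler_pM2l.
have -> : (p * (x / (p / t) - 1) = t * x - p)%R by field; rewrite !gt_eqF.
by nra.
Qed.

Lemma integral_expRN_half_line :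
  \int[mu]_(x in `]0%R, +oo[) (expR (- x))%:E = 1.
Proof.
rewrite -[RHS](_ : \int[mu]_(u in `[0%R, +oo[) (expR (- u))%:E = 1); last first.
  by rewrite integral_expRN_ray oppr0 expR0.
rewrite integral_itv_obnd_cbnd//.
apply/measurable_EFinP/measurable_funTS; apply: measurableT_comp => //.
Qed.

End power_substitution.

(** * The Gamma function *)

Section gamma_function.
Local Open Scope ereal_scope.
Context {R : realType}.
Local Notation mu := (@lebesgue_measure R).
Implicit Types a : R.

Lemma measurable_Gamma_integrand a :
  measurable_fun [set: R] (fun y : R => y `^ (a - 1) * expR (- y))%R.
Proof.
apply: measurable_funM => //.
by apply: measurableT_comp => //; exact: measurable_funN.
Qed.

Lemma Gamma_gt0 a : 0 < Gamma a.
Proof.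
apply: integral_half_line_gt0.
  by apply/measurable_EFinP; exact: measurable_Gamma_integrand.
by move=> x x0; rewrite lte_fin mulr_gt0 ?powR_gt0 ?expR_gt0.
Qed.

Lemma Gamma1 : Gamma 1 = 1%:E :> \bar R.
Proof.
rewrite -integral_expRN_half_line; apply: eq_integral_half_line => x x0.
by rewrite subrr powRr0 mul1r.
Qed.

(** The substitution v = y^a turns the integral into the length of ]0, w^a].  This
gives the primitive of a y^(a - 1) without a boundary argument at 0, where that
function may be unbounded. *)
Lemma integral_powR_le a (w : R) : (0 < a)%R -> (0 < w)%R ->
  \int[mu]_(y in `]0%R, +oo[) ((\1_`]-oo, w] y)%:E * (a * y `^ (a - 1))%R%:E)
  = (w `^ a)%R%:E.
Proof.
move=> a0 w0.
have wa0 : (0 < w `^ a)%R by rewrite powR_gt0.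
transitivity (\int[mu]_(v in `]0%R, +oo[) (\1_`]-oo, (w `^ a)%R] v)%:E).
  rewrite [RHS](@ge0_integral_powR _ _ 1 a)//; last 2 first.
  - by rewrite gt_eqF.
  - by apply/measurable_EFinP; exact: measurable_indic.
  apply: eq_integral_half_line => x x0.
  rewrite powR1 gtr0_norm// mulr1 mul1r; congr ((_)%:E * _).
  rewrite !indicE !mem_setE/= !in_itv/=.
  by rewrite -[in RHS]ler_ln ?posrE ?powR_gt0// !ln_powR ler_pM2l// ler_ln.
rewrite integral_indic//.
transitivity (mu `]0%R, (w `^ a)%R]%classic).
  by congr (mu _); apply/seteqP; split => x /=; rewrite !in_itv/= andbT;
    [move=> [-> ->]|move=> /andP[]].
by rewrite lebesgue_measure_itv/= lte_fin wa0 oppr0 adde0.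
Qed.

(** Tonelli replaces an integration by parts: integrating
a y^(a - 1) exp (- w) over 0 < y <= w first in w gives a Gamma a, and first in y
gives Gamma (a + 1). *)
Lemma GammaS a : (0 < a)%R -> Gamma (a + 1) = a%:E * Gamma a.
Proof.
move=> a0.
pose F (p : measurableTypeR R * measurableTypeR R) : \bar R :=
  (if (0 < p.1) && (p.1 <= p.2) then a * p.1 `^ (a - 1) * expR (- p.2)
   else 0)%R%:E.
have F0 p : 0 <= F p.
  by rewrite lee_fin; case: ifP => // _; rewrite !mulr_ge0 ?powR_ge0 ?expR_ge0// ltW.
have mF : measurable_fun [set: measurableTypeR R * measurableTypeR R] F.
  apply/measurable_EFinP; apply: measurable_fun_ifT => //.
    by apply: measurable_and; [exact: measurable_fun_ltr|exact: measurable_fun_ler].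
  apply: measurable_funM; first apply: measurable_funM => //.
    by apply: (measurableT_comp (measurable_powR _)).
  by apply: measurableT_comp => //; exact: measurable_funN.
have mexpN : measurable_fun [set: R] (fun y : R => expR (- y)).
  by apply: measurableT_comp => //; exact: measurable_funN.
have := fubini_tonelli F mF F0; rewrite /fubini_F /fubini_G => FT.
transitivity (\int[mu]_w \int[mu]_y F (y, w)).
  rewrite /Gamma integral_mul_indic; apply: eq_integral => w _.
  rewrite indicE half_lineE /F/=; case: ltP => w0; last first.
    rewrite mule0 integral0_eq// => y _; case: ifP => // /andP[y0 yw].
    by move: (lt_le_trans y0 yw); rewrite ltNge w0.
  rewrite mule1 addrK EFinM -(integral_powR_le a0 w0) -ge0_integralZr//; last 2 first.
  - apply: measurable_funTS; apply: emeasurable_funM; apply/measurable_EFinP.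
      exact: measurable_indic.
    by apply: measurable_funM.
  - by move=> y _; rewrite mule_ge0// lee_fin// mulr_ge0 ?powR_ge0// ltW.
  rewrite integral_mul_indic; apply: eq_integral => y _.
  rewrite !indicE half_lineE mem_setE/= in_itv/=.
  by case: (ltP 0%R y) => y0; case: (leP y w) => yw /=;
    rewrite ?mule0 ?mul0e// mul1e mule1 -EFinM.
rewrite -FT -ge0_integralZl; last 4 first.
- by [].
- by apply/measurable_EFinP/measurable_funTS; exact: measurable_Gamma_integrand.
- by move=> y _; rewrite lee_fin mulr_ge0 ?powR_ge0 ?expR_ge0.
- by rewrite lee_fin ltW.
rewrite [RHS]integral_mul_indic; apply: eq_integral => y _.
rewrite indicE half_lineE /F/=; case: ltP => y0 /=; last first.
  by rewrite mule0 integral0_eq.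
rewrite mule1 -EFinM mulrA EFinM -integral_expRN_ray -ge0_integralZl//; last 2 first.
- exact/measurable_EFinP/measurable_funTS.
- by rewrite lee_fin mulr_ge0 ?powR_ge0// ltW.
rewrite [RHS]integral_mul_indic; apply: eq_integral => w _.
rewrite indicE mem_setE/= in_itv/= andbT.
by case: ifP; rewrite ?mule0// mule1 -EFinM.
Qed.

(** By the functional equation it is enough to treat the exponent a + 1, where the
integrand y^a exp (- y) is bounded at 0 and at most a constant times
exp (- y / 2). *)
Lemma Gamma_lty a : (0 < a)%R -> Gamma a < +oo.
Proof.
move=> a0.
suff: Gamma (a + 1) < +oo.
  rewrite GammaS// => h; have [//|] := ltP (Gamma a) +oo.
  by rewrite leye_eq => /eqP aoo; move: h; rewrite aoo gt0_muley// lte_fin.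
apply: (@le_lt_trans _ _ (\int[mu]_(y in `]0%R, +oo[)
    (((2 * a) `^ a)%R%:E * (expR (- (2^-1 * y)))%:E))).
  apply: ge0_le_integral => //.
  - by move=> x _; rewrite lee_fin mulr_ge0 ?powR_ge0 ?expR_ge0.
  - by apply/measurable_EFinP/measurable_funTS; exact: measurable_Gamma_integrand.
  - apply/measurable_EFinP/measurable_funTS; apply: measurable_funM => //.
    by apply: measurableT_comp => //; apply: measurable_funN; exact: measurable_funM.
  - move=> x /=; rewrite in_itv/= andbT => x0; rewrite -EFinM lee_fin addrK.
    have := @powR_expRN_le R a 2^-1 x a0 _ x0.
    rewrite invrK [(a * 2)%R]mulrC => /(_ ltac:(by rewrite invr_gt0)) h.
    rewrite (_ : expR (- x) = expR (- (2^-1 * x)) * expR (- (2^-1 * x)))%R.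
      by rewrite mulrA ler_wpM2r// expR_ge0.
    by rewrite -expRD; congr expR; field.
have me : measurable_fun [set: R] (fun x : R => expR (- (2^-1 * x))).
  by apply: measurableT_comp => //; apply: measurable_funN; exact: measurable_funM.
rewrite ge0_integralZl//; last 2 first.
- exact/measurable_EFinP/measurable_funTS.
- by rewrite lee_fin powR_ge0.
apply: lte_mul_pinfty => //; first by rewrite lee_fin powR_ge0.
have : \int[mu]_(x in `]0%R, +oo[) ((expR (- (2^-1 * x)))%:E * (2^-1)%:E) = 1.
  rewrite -integral_expRN_half_line.
  rewrite -(@ge0_integral_scale R (fun y => (expR (- y))%:E) 2^-1)//.
  by apply/measurable_EFinP; apply: measurableT_comp => //; exact: measurable_funN.
rewrite ge0_integralZr//; last exact/measurable_EFinP/measurable_funTS.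
move=> h; rewrite ltNge leye_eq; apply/eqP => hoo.
by move: h; rewrite hoo gt0_mulye// lte_fin invr_gt0.
Qed.

End gamma_function.

(** * Stretched exponential and Krätzel integrals *)

Section stretched_exponential.
Local Open Scope ereal_scope.
Context {R : realType}.
Local Notation mu := (@lebesgue_measure R).
Variables b c : R.
Hypotheses (b0 : (0 < b)%R) (c0 : c != 0%R).

(** The Laplace transform at t of x^p exp (- (b x)^c).  Up to constant
factors these are the moments of the Stacy law at t = 0 and Krätzel functions of
t at t > 0. *)
Definition stretched_laplace (p t : R) : \bar R :=
  \int[mu]_(x in `]0%R, +oo[) (x `^ p * expR (- (t * x) - (b * x) `^ c))%R%:E.

Let mstretched p t : measurable_fun [set: R]
  (fun x : R => x `^ p * expR (- (t * x) - (b * x) `^ c))%R.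
Proof.
apply: measurable_funM => //; apply: measurableT_comp => //.
apply: measurable_funB.
  by apply: measurable_funN; exact: measurable_funM.
by apply: (measurableT_comp (measurable_powR c)); exact: measurable_funM.
Qed.

Lemma measurable_stretched (D : set R) p t : measurable_fun D
  (fun x : R => (x `^ p * expR (- (t * x) - (b * x) `^ c))%R%:E).
Proof. by apply/measurable_EFinP/measurable_funTS; exact: mstretched. Qed.

Lemma stretched_laplace_gt0 p t : 0 < stretched_laplace p t.
Proof.
apply: integral_half_line_gt0.
  by apply/measurable_EFinP; exact: mstretched.
by move=> x x0; rewrite lte_fin mulr_gt0 ?powR_gt0 ?expR_gt0.
Qed.

(** Substitution y = (b x)^c in the Gamma integral. *)
Lemma Gamma_stretched a :
  Gamma a = (`|c| * b `^ (c * a))%R%:E * stretched_laplace (c * a - 1) 0.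
Proof.
rewrite /Gamma (@ge0_integral_powR _ _ b c)//; last 2 first.
- by apply/measurable_EFinP; exact: measurable_Gamma_integrand.
- by move=> y; rewrite lee_fin mulr_ge0 ?powR_ge0 ?expR_ge0.
rewrite -ge0_integralZl//; last 3 first.
- by apply/measurable_EFinP/measurable_funTS; exact: mstretched.
- by move=> x _; rewrite lee_fin mulr_ge0 ?powR_ge0 ?expR_ge0.
- by rewrite lee_fin mulr_ge0// powR_ge0.
apply: eq_integral_half_line => x x0.
have bx0 : (0 < b * x)%R by rewrite mulr_gt0.
rewrite -!EFinM; congr EFin.
rewrite mul0r oppr0 sub0r !gt0_powRE ?expR_gt0// !expRK lnM ?posrE//.
rewrite [LHS](_ : _ = `|c| * (expR (c * (ln b + ln x) * (a - 1)) *
  expR (c * ln b) * expR ((c - 1) * ln x)) *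
  expR (- expR (c * (ln b + ln x))))%R; last first.
  by rewrite [((a - 1) * _)%R]mulrC; ring.
rewrite [RHS](_ : _ = `|c| * (expR (c * a * ln b) *
  expR ((c * a - 1) * ln x)) *
  expR (- expR (c * (ln b + ln x))))%R; last by ring.
rewrite -!expRD; congr (_ * expR _ * _)%R; ring.
Qed.

(** For z > -1 the factor x^(z + 1) exp (- t x) is bounded, which leaves a Gamma
integral. *)
Lemma stretched_laplace_lty (a z t : R) : (0 < a)%R -> (0 < t)%R -> (-1 < z)%R ->
  stretched_laplace (c * a + z) t < +oo.
Proof.
move=> a0 t0 z1.
have z10 : (0 < z + 1)%R by rewrite -ltrBlDr sub0r.
pose M := (((z + 1) / t) `^ (z + 1))%R.
apply: (@le_lt_trans _ _ (M%:E * stretched_laplace (c * a - 1) 0)).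
  rewrite -ge0_integralZl//; last 3 first.
  - by apply/measurable_EFinP/measurable_funTS; exact: mstretched.
  - by move=> x _; rewrite lee_fin mulr_ge0 ?powR_ge0 ?expR_ge0.
  - by rewrite lee_fin powR_ge0.
  apply: ge0_le_integral => //.
  - by move=> x _; rewrite lee_fin mulr_ge0 ?powR_ge0 ?expR_ge0.
  - by apply/measurable_EFinP/measurable_funTS; exact: mstretched.
  - apply/measurable_EFinP/measurable_funTS.
    by apply: measurable_funM => //; exact: mstretched.
  - move=> x /=; rewrite in_itv/= andbT => x0; rewrite -EFinM lee_fin.
    rewrite mul0r oppr0 sub0r expRD.
    rewrite (_ : c * a + z = (c * a - 1) + (z + 1))%R; last by ring.
    rewrite (@powRD _ x); last by rewrite (gt_eqF x0) implybT.
    rewrite [leLHS](_ : _ = x `^ (z + 1) * expR (- (t * x)) *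
      (x `^ (c * a - 1) * expR (- (b * x) `^ c)))%R; last by ring.
    by rewrite ler_wpM2r ?powR_expRN_le// mulr_ge0 ?powR_ge0 ?expR_ge0.
apply: lte_mul_pinfty; rewrite ?lee_fin ?powR_ge0//.
rewrite ltNge leye_eq; apply/eqP => soo.
have := Gamma_lty a0; rewrite Gamma_stretched soo gt0_muley//.
by rewrite lte_fin mulr_gt0 ?normr_gt0 ?powR_gt0.
Qed.

(** Substitution y = 1 / (b x) in the Krätzel integral. *)
Lemma kratzelE (p t : R) : (0 < t)%R ->
  kratzel (- c) (- p - 1) (t / b) =
  (b `^ (p + 1) * fine (stretched_laplace p t))%R.
Proof.
move=> t0.
have bp0 : (0 < b `^ (p + 1))%R by rewrite powR_gt0.
transitivity (fine ((b `^ (p + 1))%:E * stretched_laplace p t)%E); last first.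
  have := stretched_laplace_gt0 p t.
  case: (stretched_laplace p t) => // _; rewrite gt0_muley// ?lte_fin//=.
  by rewrite mulr0.
have mkratzel : measurable_fun [set: R]
    (fun y : R => y `^ (- p - 1 - 1) * expR (- (y `^ (- c) + t / b / y)))%R.
  apply: measurable_funM => //; apply: measurableT_comp => //.
  apply: measurable_funN; apply: measurable_funD => //.
  by apply: measurable_funM => //; exact: measurable_funV.
congr fine; rewrite (@ge0_integral_powR _ _ b (-1))//; last 2 first.
- by apply/measurable_EFinP; exact: mkratzel.
- by move=> y; rewrite lee_fin mulr_ge0 ?powR_ge0 ?expR_ge0.
rewrite -ge0_integralZl//; last 3 first.
- by apply/measurable_EFinP/measurable_funTS; exact: mstretched.
- by move=> x _; rewrite lee_fin mulr_ge0 ?powR_ge0 ?expR_ge0.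
- by rewrite lee_fin powR_ge0.
apply: eq_integral_half_line => x x0.
have bx0 : (0 < b * x)%R by rewrite mulr_gt0.
rewrite -!EFinM; congr EFin.
have -> : (t / b / (b * x) `^ (-1) = t * x)%R.
  by rewrite powR_inv1 ?ltW// invrK; field; rewrite gt_eqF.
rewrite !gt0_powRE ?expR_gt0// !expRK lnM ?posrE// normrN1 mul1r.
rewrite (_ : - c * (-1 * (ln b + ln x)) = c * (ln b + ln x))%R; last by ring.
rewrite -!expRD; congr expR; ring.
Qed.

End stretched_exponential.

(** * Random variables and kernels with a density *)

Section densities_of_random_variables.
Local Open Scope ereal_scope.
Context d (T : measurableType d) (R : realType) (P : {measure set T -> \bar R}).

Lemma ge0_integral_pushforward_density d' (U : measurableType d')
    (mu : {measure set U -> \bar R}) (X : T -> U) (f : U -> R)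
    (g : U -> \bar R) :
  measurable_fun [set: T] X -> density_of mu (pushforward P X) f ->
  (forall x, 0 <= g x) -> measurable_fun [set: U] g ->
  \int[P]_w g (X w) = \int[mu]_x (g x * (f x)%:E).
Proof.
move=> mX Xf g0 mg.
rewrite -(@ge0_integral_density _ _ _ _ (pushforward_measure P mX))//.
by rewrite [RHS]ge0_integral_pushforward.
Qed.

End densities_of_random_variables.

Section product_densities.
Local Open Scope ereal_scope.
Context d (T : measurableType d) (R : realType) (P : probability T R).
Context d1 d2 (U1 : measurableType d1) (U2 : measurableType d2).
Variables (m1 : {sigma_finite_measure set U1 -> \bar R})
  (m2 : {sigma_finite_measure set U2 -> \bar R}).

(** A candidate joint density has to be tested on rectangles only. *)
Lemma density_of_rect (X : T -> U1) (Y : T -> U2) (f : U1 * U2 -> R) :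
  measurable_fun [set: T] X -> measurable_fun [set: T] Y ->
  (forall p, (0 <= f p)%R) -> measurable_fun [set: U1 * U2] f ->
  (forall A B, measurable A -> measurable B ->
    P (X @^-1` A `&` Y @^-1` B) =
    \int[m2]_(y in B) \int[m1]_(x in A) (f (x, y))%:E) ->
  density_of (m1 \x m2) (pushforward P (fun w => (X w, Y w))) f.
Proof.
move=> mX mY f0 mf PE; split => // C mC.
have f0E p : 0 <= (EFin \o f) p by rewrite lee_fin.
have mfE : measurable_fun [set: U1 * U2] (EFin \o f) by exact/measurable_EFinP.
have mXY : measurable_fun [set: T] (fun w => (X w, Y w)).
  exact: measurable_fun_pair.
apply: (@measure_rect_unique _ _ _ _ _ (pushforward_measure P mXY)
  (measure_of_density (m1 \x m2) f0E mfE)) => //.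
  by rewrite /= /pushforward preimage_setT probability_setT ltry.
move=> A B mA mB.
rewrite [LHS](_ : _ = P (X @^-1` A `&` Y @^-1` B))// PE//.
rewrite [RHS]integral_mkcond epatch_indic.
rewrite fubini_tonelli2//.
- rewrite [LHS]integral_mkcond epatch_indic.
  apply: eq_integral => y _; rewrite /fubini_G.
  rewrite [X in X * _]integral_mkcond epatch_indic -ge0_integralZr//; last 3 first.
  - apply: (@emeasurable_funM _ _ _ _ (fun x => (f (x, y))%:E) (EFin \o \1_A)).
      exact: (measurableT_comp mfE).
    by apply/measurable_EFinP; exact: measurable_indic.
  - by move=> x _; rewrite mule_ge0// lee_fin.
  - by rewrite /= lee_fin.
  apply: eq_integral => x _ /=; rewrite -!EFinM; congr EFin.
  rewrite -mulrA; congr (_ * _)%R; rewrite !indicE -natrM mulnb.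
  by rewrite in_setX.
- apply: emeasurable_funM => //; apply/measurable_EFinP.
  by apply: measurable_indic; exact: measurableX.
- by move=> p; rewrite mule_ge0// lee_fin.
Qed.

Lemma probability_rect_density (X : T -> U1) (Y : T -> U2) (f : U1 * U2 -> R) A B :
  density_of (m1 \x m2) (pushforward P (fun w => (X w, Y w))) f ->
  measurable A -> measurable B ->
  P (X @^-1` A `&` Y @^-1` B) =
  \int[m1]_(x in A) \int[m2]_(y in B) (f (x, y))%:E.
Proof.
move=> [f0 mf fE] mA mB.
have mfE : measurable_fun [set: U1 * U2] (EFin \o f) by exact/measurable_EFinP.
rewrite [LHS](fE (A `*` B)); last exact: measurableX.
rewrite [LHS]integral_mkcond epatch_indic.
rewrite fubini_tonelli1; last 2 first.
- apply: emeasurable_funM => //; apply/measurable_EFinP.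
  by apply: measurable_indic; exact: measurableX.
- by move=> p; rewrite mule_ge0// lee_fin.
rewrite [RHS]integral_mkcond epatch_indic.
apply: eq_integral => x _; rewrite /fubini_F.
rewrite [X in X * _]integral_mkcond epatch_indic -ge0_integralZr; last 4 first.
- by [].
- apply: (@emeasurable_funM _ _ _ _ (fun y => (f (x, y))%:E) (EFin \o \1_B)).
    exact: (measurableT_comp mfE).
  by apply/measurable_EFinP; exact: measurable_indic.
- by move=> y _; rewrite mule_ge0// lee_fin.
- by rewrite /= lee_fin.
apply: eq_integral => y _ /=; rewrite -!EFinM; congr EFin.
rewrite -mulrA; congr (_ * _)%R; rewrite !indicE -natrM mulnb.
by rewrite in_setX andbC.
Qed.

Lemma density_of_independent (X : T -> U1) (Y : T -> U2) (f : U1 -> R) (g : U2 -> R) :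
  measurable_fun [set: T] X -> measurable_fun [set: T] Y ->
  density_of m1 (pushforward P X) f -> density_of m2 (pushforward P Y) g ->
  independent_RV P X Y ->
  density_of (m1 \x m2) (pushforward P (fun w => (X w, Y w)))
    (fun p => f p.1 * g p.2)%R.
Proof.
move=> mX mY [f0 mf fE] [g0 mg gE] XY; apply: density_of_rect => //.
- by move=> p; rewrite mulr_ge0.
- by apply: measurable_funM; [exact: (measurableT_comp mf)|exact: (measurableT_comp mg)].
move=> A B mA mB; rewrite XY//.
have -> : P (X @^-1` A) = \int[m1]_(x in A) (f x)%:E by exact: fE.
have -> : P (Y @^-1` B) = \int[m2]_(y in B) (g y)%:E by exact: gE.
rewrite -ge0_integralZl//; last 3 first.
- exact/measurable_EFinP/measurable_funTS.
- by move=> y _; rewrite lee_fin.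
- by apply: integral_ge0 => x _; rewrite lee_fin.
apply: eq_integral => y _; rewrite -ge0_integralZr ?lee_fin//.
  exact/measurable_EFinP/measurable_funTS.
by move=> x _; rewrite lee_fin.
Qed.

End product_densities.

Section real_densities.
Local Open Scope ereal_scope.
Context d (T : measurableType d) (R : realType) (P : {measure set T -> \bar R}).
Local Notation mu := (@lebesgue_measure R).

(** The expectation is the difference of the integrals of the positive and
negative parts; the negative part vanishes where the density does not. *)
Lemma integral_id_density (X : T -> R) (f : R -> R) :
  measurable_fun [set: T] X -> density_of mu (pushforward P X) f ->
  (forall x, (x < 0)%R -> f x = 0%R) ->
  \int[P]_w (X w)%:E = \int[mu]_(y in `]0%R, +oo[) (y * f y)%R%:E.
Proof.
move=> mX Xf fN.
have mEFin : measurable_fun [set: R] (@EFin R) by exact/measurable_EFinP.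
pose pos (y : R) := (@EFin R)^\+ y; pose neg (y : R) := (@EFin R)^\- y.
transitivity (\int[P]_w pos (X w) - \int[P]_w neg (X w)).
  by rewrite integralE; congr (_ - _); apply: eq_integral => w _;
    rewrite /pos /neg ?funeposE ?funenegE.
have mpos : measurable_fun [set: R] pos by exact: measurable_funepos.
have mneg : measurable_fun [set: R] neg by exact: measurable_funeneg.
have pos0 y : 0 <= pos y by exact: funepos_ge0.
have neg0 y : 0 <= neg y by exact: funeneg_ge0.
have mX' : measurable_fun [set: T] (X : T -> measurableTypeR R) by exact: mX.
rewrite (ge0_integral_pushforward_density mX' Xf pos0 mpos).
rewrite (ge0_integral_pushforward_density mX' Xf neg0 mneg).
rewrite [X in _ - X]integral0_eq ?sube0.
  rewrite [RHS]integral_mul_indic; apply: eq_integral => x _.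
  rewrite /pos funeposE indicE half_lineE.
  have [x0|x0] := ltP 0%R x.
    by rewrite max_l ?lee_fin ?ltW// mule1 -EFinM.
  by rewrite mule0 max_r ?mul0e// lee_fin.
move=> x _; rewrite /neg funenegE.
have [x0|x0] := ltP x 0%R; first by rewrite fN// mule0.
by rewrite max_r ?mul0e// -EFinN lee_fin oppr_le0.
Qed.

End real_densities.

Section real_random_variables.
Local Open Scope ereal_scope.
Context {R : realType}.
Local Notation mu := (@lebesgue_measure R).
Context d (T : measurableType d) (P : probability T R).

Lemma ge0_integral_half_line_density (X : T -> R) (f g : R -> R) :
  measurable_fun [set: T] X -> density_of mu (pushforward P X) f ->
  (forall x, (x <= 0)%R -> f x = 0%R) ->
  measurable_fun [set: R] g -> (forall y, 0 <= g y)%R ->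
  \int[P]_w (g (X w))%:E = \int[mu]_(y in `]0%R, +oo[) (g y * f y)%R%:E.
Proof.
move=> mX Xf fN mg g0.
have mX' : measurable_fun [set: T] (X : T -> measurableTypeR R) by exact: mX.
rewrite (@ge0_integral_pushforward_density _ _ _ _ _ (measurableTypeR R) mu X f
  (EFin \o g) mX' Xf)//; last exact/measurable_EFinP.
rewrite [RHS]integral_mul_indic; apply: eq_integral => y _.
rewrite indicE half_lineE; have [y0|y0] := ltP 0%R y; first by rewrite mule1 EFinM.
by rewrite fN// !mule0.
Qed.

(** With m the mean, the nonnegative functions (y - m)^2 + 2 m y and y^2 + m^2 are
equal.  Integrating them in the extended reals gives V + 2 m^2 = E (X^2) + m^2,
an identity that stays valid when the second moment is infinite. *)
Lemma variance_density (X : T -> R) (f : R -> R) :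
  measurable_fun [set: T] X -> density_of mu (pushforward P X) f ->
  (forall x, (x <= 0)%R -> f x = 0%R) ->
  \int[mu]_(y in `]0%R, +oo[) (y * f y)%R%:E < +oo ->
  'V_P[X] = \int[mu]_(y in `]0%R, +oo[) (y ^+ 2 * f y)%R%:E -
    (\int[mu]_(y in `]0%R, +oo[) (y * f y)%R%:E) ^+ 2.
Proof.
move=> mX Xf fN m1oo.
have [f0 mf fE] := Xf.
have fle y : (y < 0)%R -> f y = 0%R by move=> /ltW/fN.
have EX := integral_id_density mX Xf fle.
have m1ge0 : 0 <= \int[mu]_(y in `]0%R, +oo[) (y * f y)%R%:E.
  apply: integral_ge0 => y /=; rewrite in_itv/= andbT => y0.
  by rewrite lee_fin mulr_ge0// ltW.
have m1fin : \int[mu]_(y in `]0%R, +oo[) (y * f y)%R%:E \is a fin_num.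
  by rewrite ge0_fin_numE.
pose m := fine (\int[mu]_(y in `]0%R, +oo[) (y * f y)%R%:E).
have mE : \int[mu]_(y in `]0%R, +oo[) (y * f y)%R%:E = m%:E by rewrite fineK.
have m0 : (0 <= m)%R by rewrite fine_ge0.
have half_line g := @ge0_integral_half_line_density X f g mX Xf fN.
have VE : 'V_P[X] = \int[mu]_(y in `]0%R, +oo[) ((y - m) ^+ 2 * f y)%R%:E.
  rewrite -(@half_line (fun y => (y - m) ^+ 2)%R); last 2 first.
  - by apply: measurable_funX; exact: measurable_funB.
  - by move=> y; exact: sqr_ge0.
  rewrite /variance !unlock EX -/m.
  by apply: eq_integral => w _; rewrite /= expr2.
have f1 : \int[mu]_(y in `]0%R, +oo[) (m ^+ 2 * f y)%R%:E = (m ^+ 2)%:E.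
  rewrite -(@half_line (fun=> m ^+ 2)%R)//; last by move=> _; exact: sqr_ge0.
  rewrite (_ : (fun w => _) = cst (m ^+ 2)%:E)// integral_cst//.
  by rewrite [X in _ * X](_ : _ = 1) ?mule1//; exact: probability_setT.
have mmf (g : R -> R) : measurable_fun [set: R] g ->
    measurable_fun (`]0%R, +oo[ : set R) (fun y => (g y * f y)%R%:E).
  by move=> mg; apply/measurable_EFinP/measurable_funTS; exact: measurable_funM.
have gf0 (g : R -> R) : (forall y, 0 < y -> 0 <= g y)%R ->
    forall y, (`]0%R, +oo[%classic : set R) y -> 0 <= (g y * f y)%R%:E.
  move=> g0 y; rewrite /= in_itv/= andbT => y0.
  by rewrite lee_fin mulr_ge0// g0.
have mm : \int[mu]_(y in `]0%R, +oo[) (m *+ 2 * y * f y)%R%:E = (m ^+ 2 *+ 2)%:E.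
  under eq_integral do rewrite -mulrA EFinM.
  rewrite ge0_integralZl//; last 3 first.
  - exact: (mmf id).
  - by apply: (gf0 id) => y /ltW.
  - by rewrite lee_fin mulrn_wge0.
  by rewrite mE -EFinM mulrnAl expr2.
have key : 'V_P[X] + (m ^+ 2 *+ 2)%:E =
    \int[mu]_(y in `]0%R, +oo[) (y ^+ 2 * f y)%R%:E + (m ^+ 2)%:E.
  rewrite VE -mm -f1 -ge0_integralD; last 5 first.
  - by [].
  - by apply: (gf0 (fun y => (y - m) ^+ 2)%R) => y _; exact: sqr_ge0.
  - apply: (mmf (fun y => (y - m) ^+ 2)%R).
    by apply: measurable_funX; exact: measurable_funB.
  - by apply: (gf0 (fun y => m *+ 2 * y)%R) => y /ltW y0; rewrite mulr_ge0// mulrn_wge0.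
  - by apply: (mmf (fun y => m *+ 2 * y)%R); exact: measurable_funM.
  rewrite -ge0_integralD; last 5 first.
  - by [].
  - by apply: (gf0 (fun y => y ^+ 2)%R) => y _; exact: sqr_ge0.
  - by apply: (mmf (fun y => y ^+ 2)%R); exact: measurable_funX.
  - by apply: (gf0 (fun=> m ^+ 2)%R) => y _; exact: sqr_ge0.
  - by apply: (mmf (fun=> m ^+ 2)%R).
  by apply: eq_integral => y _; rewrite -!EFinD; congr EFin; ring.
rewrite mE -EFin_expe -[LHS](addeK (x := (m ^+ 2 *+ 2)%:E))// key.
rewrite -addeA -EFinN -EFinD; congr (_ + _%:E); ring.
Qed.

Lemma density_of_scale (X : T -> R) (f : R -> R) (k : R) : (0 < k)%R ->
  density_of mu (pushforward P X) f ->
  density_of mu (pushforward P (fun w => k * X w)%R) (fun x => f (x / k) / k)%R.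
Proof.
move=> k0 [f0 mf fE]; split.
- by move=> x; rewrite divr_ge0// ltW.
- by apply: measurable_funM => //; apply: (measurableT_comp mf); exact: measurable_funM.
move=> A mA.
have mk : measurable_fun [set: R] (fun x : R => k * x)%R by exact: measurable_funM.
have mkA : measurable ((fun x : R => k * x)%R @^-1` A).
  by rewrite -[X in measurable X]setTI; exact: mk.
rewrite [LHS](fE _ mkA) [LHS]integral_mul_indic [RHS]integral_mul_indic.
rewrite [RHS](@ge0_integral_affine _ _ k 0)//; last 3 first.
- by rewrite gt_eqF.
- apply: emeasurable_funM; apply/measurable_EFinP.
    by apply: measurable_funM => //; apply: (measurableT_comp mf); exact: measurable_funM.
  exact: measurable_indic.
- by move=> y; rewrite mule_ge0// lee_fin// divr_ge0// ltW.
apply: eq_integral => x _.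
have kn0 : k != 0%R by rewrite gt_eqF.
rewrite addr0 gtr0_norm// -!EFinM; congr EFin.
rewrite -[\1_A (k * x)%R]/(\1_((fun x => k * x)%R @^-1` A) x).
by rewrite mulrAC divfK// mulrAC mulfV// mul1r.
Qed.

End real_random_variables.

Section density_kernel.
Local Open Scope ereal_scope.
Context d (X : measurableType d) (R : realType).
Local Notation mu := (@lebesgue_measure R).
Variable f : X * measurableTypeR R -> R.
Hypotheses (f0 : forall p, (0 <= f p)%R) (mf : measurable_fun setT f).

Let f0E x y : 0 <= (f (x, y))%:E.
Proof. by rewrite lee_fin. Qed.

Let mfE x : measurable_fun [set: measurableTypeR R] (fun y => (f (x, y))%:E).
Proof. by apply/measurable_EFinP; exact: measurableT_comp. Qed.

Let midR : measurable_fun [set: measurableTypeR R] (fun y : measurableTypeR R => y : R).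
Proof. by []. Qed.

(** Lebesgue measure lives on [measurableTypeR R], whereas the target of the kernel is
[R] with its own structure; the image under the identity converts between
the two. *)
Definition density_kernel (x : X) : {measure set R -> \bar R} :=
  pushforward_measure (measure_of_density mu (f0E x) (mfE x)) midR.

Let measurable_density_kernel A : measurable A ->
  measurable_fun [set: X] (density_kernel ^~ A).
Proof.
move=> mA.
rewrite (_ : density_kernel ^~ A =
    (fun x => \int[mu]_y (f (x, y) * \1_A y)%:E)); last first.
  by apply/funext => x; rewrite [LHS]integral_mkcond epatch_indic.
apply: (@measurable_fun_fubini_tonelli_F _ _ _ _ _ mu
  (fun p : X * measurableTypeR R => (f p * \1_A p.2)%:E)).
  apply/measurable_EFinP; apply: measurable_funM => //.
  have mi : measurable_fun [set: R] (\1_A : R -> R) by exact: measurable_indic.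
  apply: (@measurableT_comp _ _ _ _ _ _ (\1_A : R -> R)) => //.
by move=> p; rewrite lee_fin mulr_ge0.
Qed.

HB.instance Definition _ :=
  isKernel.Build _ _ X R R density_kernel measurable_density_kernel.

Hypothesis f1 : forall x, \int[mu]_y (f (x, y))%:E = 1.

Let density_kernel_setT x : density_kernel x setT = 1.
Proof. exact: f1. Qed.

HB.instance Definition _ :=
  Kernel_isProbability.Build _ _ X R R density_kernel density_kernel_setT.

Lemma density_pker : exists k : R.-pker X ~> R,
  forall x A, k x A = \int[mu]_(y in A) (f (x, y))%:E.
Proof. by exists density_kernel. Qed.

End density_kernel.

(** * The exponential distribution *)

Section exponential.
Local Open Scope ereal_scope.
Context {R : realType}.
Local Notation mu := (@lebesgue_measure R).
Implicit Types (l : R) (B : set R).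

Lemma measurable_exponential_density l :
  measurable_fun [set: R] (fun t : R => l * expR (- (t * l)))%R.
Proof.
apply: measurable_funM => //; apply: measurableT_comp => //.
by apply: measurable_funN; exact: measurable_funM.
Qed.

Lemma exponential_probE l B : measurable B ->
  exponential_prob l B =
  \int[mu]_(t in `]0%R, +oo[) (\1_B t * (l * expR (- (t * l))))%R%:E.
Proof.
move=> mB.
rewrite integral_itv_obnd_cbnd; last first.
  apply/measurable_EFinP/measurable_funTS; apply: measurable_funM.
    exact: measurable_indic.
  apply: measurable_funM => //; apply: measurableT_comp => //.
  by apply: measurable_funN; exact: measurable_funM.
rewrite /exponential_prob [LHS]integral_mul_indic [RHS]integral_mul_indic.
apply: eq_integral => t _.
rewrite /exponential_pdf patchE indicE; case: ifPn => tB.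
  by rewrite indicE tB mule1 -EFinM mulrC mulNr [(l * t)%R]mulrC.
by rewrite indicE (negbTE tB) mule0 mul0e.
Qed.

(** If t has rate l, then t l has rate 1. *)
Lemma exponential_prob_scale l B : (0 < l)%R -> measurable B ->
  exponential_prob l ((fun t => t * l)%R @^-1` B) = exponential_prob 1 B.
Proof.
move=> l0 mB.
have ml : measurable_fun [set: R] (fun t : R => t * l)%R by exact: measurable_funM.
rewrite !exponential_probE//; last by rewrite -[X in measurable X]setTI; exact: ml.
rewrite [RHS](@ge0_integral_scale _ _ l)//.
- apply: eq_integral_half_line => t t0; rewrite -EFinM; congr EFin.
  have -> : \1_((fun t => t * l)%R @^-1` B) t = \1_B (t * l)%R :> R by [].
  rewrite [(l * t)%R]mulrC mulr1 mul1r.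
  by rewrite -mulrA [(l * _)%R]mulrC.
- apply/measurable_EFinP; apply: measurable_funM; first exact: measurable_indic.
  apply: measurable_funM => //; apply: measurableT_comp => //.
  by apply: measurable_funN; exact: measurable_funM.
Qed.

Lemma exponential_moment l z : (0 < l)%R ->
  \int[mu]_(t in `]0%R, +oo[) (t `^ z * (l * expR (- (t * l))))%R%:E =
  (l `^ (- z))%R%:E * Gamma (z + 1).
Proof.
move=> l0.
rewrite /Gamma addrK [in RHS](@ge0_integral_scale _ _ l)//; last 2 first.
- apply/measurable_EFinP; apply: measurable_funM => //.
  by apply: measurableT_comp => //; exact: measurable_funN.
- by move=> y; rewrite lee_fin mulr_ge0 ?powR_ge0 ?expR_ge0.
rewrite -ge0_integralZl//; last 3 first.
- apply: measurable_funTS; apply: emeasurable_funM => //.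
  apply/measurable_EFinP; apply: measurable_funM.
    by apply: (measurableT_comp (measurable_powR z)); exact: measurable_funM.
  by apply: measurableT_comp => //; apply: measurable_funN; exact: measurable_funM.
- by move=> y _; rewrite mule_ge0// lee_fin ?mulr_ge0 ?powR_ge0 ?expR_ge0// ltW.
- by rewrite lee_fin powR_ge0.
apply: eq_integral_half_line => t t0; rewrite -!EFinM; congr EFin.
rewrite powRM ?ltW// powRN [(l * t)%R]mulrC.
have lz : (l `^ z)%R != 0%R by rewrite gt_eqF ?powR_gt0.
by field.
Qed.

Lemma exponential_mean l : (0 < l)%R ->
  \int[mu]_(t in `]0%R, +oo[) (t * (l * expR (- (t * l))))%R%:E = (l^-1)%:E.
Proof.
move=> l0.
transitivity (\int[mu]_(t in `]0%R, +oo[) (t `^ 1 * (l * expR (- (t * l))))%R%:E).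
  by apply: eq_integral_half_line => t t0; rewrite powRr1// ltW.
by rewrite exponential_moment// GammaS// Gamma1 mule1 powR_inv1 ?mule1// ltW.
Qed.

End exponential.

(** * The Stacy and Exp-Stacy densities *)

Section stacy_densities.
Local Open Scope ereal_scope.
Context {R : realType}.
Local Notation mu := (@lebesgue_measure R).
Variables alpha beta c : R.
Hypotheses (alpha0 : (0 < alpha)%R) (beta0 : (0 < beta)%R) (c0 : c != 0%R).
Local Notation s := (stacy_pdf alpha beta c).
Local Notation joint := (exp_stacy1_pdf alpha beta c).
Local Notation K := (`|c| * (beta `^ (c * alpha) / fine (Gamma alpha)))%R.

Lemma fine_Gamma_gt0 : (0 < fine (Gamma alpha))%R.
Proof. by apply: fine_gt0; rewrite Gamma_gt0 Gamma_lty. Qed.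

Lemma stacy_cst_gt0 : (0 < K)%R.
Proof. by rewrite mulr_gt0 ?normr_gt0// divr_gt0 ?powR_gt0// fine_Gamma_gt0. Qed.

Lemma stacy_pdfE (x : R) : (0 < x)%R ->
  s x = (K * (x `^ (c * alpha - 1) * expR (- (0 * x) - (beta * x) `^ c)))%R.
Proof. by move=> x0; rewrite /stacy_pdf x0 mul0r oppr0 sub0r -!mulrA. Qed.

Lemma exp_stacy1_pdfE (t x : R) : (0 < t)%R -> (0 < x)%R ->
  joint (t, x) = (s x * (x * expR (- (t * x))))%R.
Proof.
move=> t0 x0; rewrite /exp_stacy1_pdf t0 x0/= /stacy_pdf x0 expRD.
by ring.
Qed.

Lemma exp_stacy1_pdfE2 (t x : R) : (0 < t)%R -> (0 < x)%R ->
  joint (t, x) =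
  (K * (x `^ (c * alpha) * expR (- (t * x) - (beta * x) `^ c)))%R.
Proof.
move=> t0 x0; rewrite exp_stacy1_pdfE// /stacy_pdf x0 expRD.
rewrite (_ : c * alpha = 1 + (c * alpha - 1))%R; last by ring.
rewrite [in RHS](@powRD _ x 1) ?(gt_eqF x0) ?implybT// powRr1 ?ltW//.
rewrite (_ : 1 + (c * alpha - 1) = c * alpha)%R; last by ring.
by ring.
Qed.

Lemma exp_stacy1_pdf_eq0 (t x : R) : ~~ ((0 < t) && (0 < x))%R ->
  joint (t, x) = 0%R.
Proof. by move=> /negbTE h; rewrite /exp_stacy1_pdf h. Qed.

Lemma stacy_pdf_ge0 x : (0 <= s x)%R.
Proof.
rewrite /stacy_pdf; case: ifP => // x0.
by rewrite mulr_ge0 ?expR_ge0// mulr_ge0 ?powR_ge0// ltW// stacy_cst_gt0.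
Qed.

Lemma stacy_pdf_gt0 (x : R) : (0 < x)%R -> (0 < s x)%R.
Proof.
move=> x0; rewrite /stacy_pdf x0.
by rewrite mulr_gt0 ?expR_gt0// mulr_gt0 ?powR_gt0// stacy_cst_gt0.
Qed.

Lemma measurable_stacy_pdf : measurable_fun [set: R] s.
Proof.
apply: measurable_fun_ifT => //; first exact: measurable_fun_ltr.
apply: measurable_funM; first exact: measurable_funM.
apply: measurableT_comp => //; apply: measurable_funN.
by apply: (measurableT_comp (measurable_powR c)); exact: measurable_funM.
Qed.

Lemma exp_stacy1_pdf_ge0 p : (0 <= joint p)%R.
Proof.
case: p => t x; have [/andP[t0 x0]|/exp_stacy1_pdf_eq0->//] :=
  boolP ((0 < t) && (0 < x))%R.
by rewrite exp_stacy1_pdfE// !mulr_ge0 ?stacy_pdf_ge0 ?expR_ge0// ltW.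
Qed.

Lemma measurable_exp_stacy1_pdf :
  measurable_fun [set: measurableTypeR R * measurableTypeR R] joint.
Proof.
apply: (eq_measurable_fun (fun p : measurableTypeR R * measurableTypeR R =>
   if (0 < p.1) && (0 < p.2) then s p.2 * (p.2 * expR (- (p.1 * p.2)))
   else 0)%R) => [[t x] _|].
  have [/andP[t0 x0]|h] := boolP ((0 < t) && (0 < x))%R.
    by rewrite [RHS]exp_stacy1_pdfE//= t0 x0.
  by rewrite [RHS]exp_stacy1_pdf_eq0//= (negbTE h).
have ms2 : measurable_fun [set: measurableTypeR R * measurableTypeR R]
    (fun p : measurableTypeR R * measurableTypeR R => s p.2).
  by apply: (measurableT_comp measurable_stacy_pdf).
apply: measurable_fun_ifT => //.
  by apply: measurable_and; exact: measurable_fun_ltr.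
apply: measurable_funM => //; apply: measurable_funM => //.
by apply: measurableT_comp => //; apply: measurable_funN; exact: measurable_funM.
Qed.

(** The expectation of xi^-z is a Gamma integral in the variable (beta x)^c. *)
Lemma stacy_moment (z : R) :
  \int[mu]_(x in `]0%R, +oo[) ((s x)%:E * (x `^ (- z))%R%:E) =
  (beta `^ z / fine (Gamma alpha))%R%:E * Gamma (alpha - z / c).
Proof.
rewrite (Gamma_stretched beta0 c0 (alpha - z / c)) muleA -EFinM.
have -> : (c * (alpha - z / c) = c * alpha - z)%R by field.
rewrite -ge0_integralZl//; last 3 first.
- exact: measurable_stretched.
- by move=> x _; rewrite lee_fin mulr_ge0 ?powR_ge0 ?expR_ge0.
- by rewrite lee_fin mulr_ge0 ?mulr_ge0 ?invr_ge0 ?powR_ge0// ltW// fine_Gamma_gt0.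
apply: eq_integral_half_line => x x0; rewrite -!EFinM; congr EFin.
rewrite stacy_pdfE// (_ : c * alpha - z - 1 = (c * alpha - 1) + (- z))%R; last by ring.
rewrite [in RHS](@powRD _ x) ?(gt_eqF x0) ?implybT//.
rewrite (@powRD _ beta (c * alpha) (- z)) ?(gt_eqF beta0) ?implybT//.
have bz : (beta `^ z)%R != 0%R by rewrite gt_eqF// powR_gt0.
have Gn : fine (Gamma alpha) != 0%R by rewrite gt_eqF// fine_Gamma_gt0.
by rewrite (powRN beta); field; rewrite Gn bz.
Qed.

Lemma fineK_stretched_laplace (t : R) : (0 < t)%R ->
  (fine (stretched_laplace beta c (c * alpha) t))%:E =
  stretched_laplace beta c (c * alpha) t.
Proof.
move=> t0; rewrite fineK// gt0_fin_numE ?stretched_laplace_gt0//.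
by rewrite -[(c * alpha)%R]addr0 stretched_laplace_lty.
Qed.

Lemma exp_st_pdfE (t : R) : (0 < t)%R -> exp_st_pdf alpha beta c t =
  (K * fine (stretched_laplace beta c (c * alpha) t))%R.
Proof.
move=> t0; rewrite /exp_st_pdf t0 (kratzelE c beta0 (c * alpha) t0).
rewrite (@powRD _ beta) ?(gt_eqF beta0) ?implybT// powRr1 ?ltW//.
have Gn : fine (Gamma alpha) != 0%R by rewrite gt_eqF// fine_Gamma_gt0.
by field; rewrite Gn gt_eqF.
Qed.

Lemma integral_exp_stacy1_pdf (t : R) :
  \int[mu]_x (joint (t, x))%:E = (exp_st_pdf alpha beta c t)%:E.
Proof.
have [t0|t0] := ltP 0%R t; last first.
  rewrite [exp_st_pdf _ _ _ _]ifF ?ltNge ?t0// integral0_eq// => x _.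
  by rewrite exp_stacy1_pdf_eq0// (ltNge _ t) t0.
rewrite exp_st_pdfE// EFinM fineK_stretched_laplace//.
rewrite -ge0_integralZl//; last 3 first.
- exact: measurable_stretched.
- by move=> x _; rewrite lee_fin mulr_ge0 ?powR_ge0 ?expR_ge0.
- by rewrite lee_fin ltW// stacy_cst_gt0.
rewrite [RHS]integral_mul_indic; apply: eq_integral => x _.
rewrite indicE half_lineE; case: ltP => x0; last first.
  by rewrite mule0 exp_stacy1_pdf_eq0// (ltNge _ x) x0 andbF.
by rewrite mule1 -EFinM exp_stacy1_pdfE2.
Qed.

Lemma exp_st_pdf_gt0 (t : R) : (0 < t)%R -> (0 < exp_st_pdf alpha beta c t)%R.
Proof.
move=> t0; rewrite -lte_fin -integral_exp_stacy1_pdf.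
apply: (@lt_le_trans _ _ (\int[mu]_(x in `]0%R, +oo[) (joint (t, x))%:E)).
  apply: integral_half_line_gt0.
    apply/measurable_EFinP.
    by apply: (measurableT_comp measurable_exp_stacy1_pdf).
  move=> x x0; rewrite lte_fin exp_stacy1_pdfE//.
  by rewrite mulr_gt0 ?stacy_pdf_gt0// mulr_gt0 ?expR_gt0.
apply: ge0_subset_integral => //.
- apply/measurable_EFinP.
  by apply: (measurableT_comp measurable_exp_stacy1_pdf).
- by move=> x _; rewrite lee_fin exp_stacy1_pdf_ge0.
Qed.

End stacy_densities.

(** * The joint law and its consequences *)

Section joint_law.
Local Open Scope ereal_scope.
Context {R : realType}.
Local Notation mu := (@lebesgue_measure R).
Local Notation RR := (measurableTypeR R * measurableTypeR R)%type.
Variables alpha beta c : R.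
Hypotheses (alpha0 : (0 < alpha)%R) (beta0 : (0 < beta)%R) (c0 : c != 0%R).
Local Notation s := (stacy_pdf alpha beta c).
Local Notation joint := (exp_stacy1_pdf alpha beta c).

Let joint_ge0 := exp_stacy1_pdf_ge0 alpha0 beta0 c0.
Let mjoint := measurable_exp_stacy1_pdf alpha beta c.

Lemma ge0_integral_exp_stacy1 (g : RR -> \bar R) :
  (forall p, 0 <= g p) -> measurable_fun [set: RR] g ->
  \int[mu \x mu]_p (g p * (joint p)%:E) =
  \int[mu]_(x in `]0%R, +oo[) ((s x)%:E *
    \int[mu]_(t in `]0%R, +oo[) (g (t, x) * (x * expR (- (t * x)))%R%:E)).
Proof.
move=> g0 mg; rewrite fubini_tonelli2//; last 2 first.
- by apply: emeasurable_funM => //; exact/measurable_EFinP.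
- by move=> p; rewrite mule_ge0// lee_fin.
rewrite [RHS]integral_mul_indic; apply: eq_integral => x _; rewrite /fubini_G.
rewrite indicE half_lineE; case: ltP => x0; last first.
  rewrite mule0 integral0_eq// => t _.
  by rewrite exp_stacy1_pdf_eq0 ?mule0// (ltNge _ x) x0 andbF.
rewrite mule1 -ge0_integralZl//; last 3 first.
- apply: measurable_funTS; apply: emeasurable_funM.
    exact: (measurableT_comp mg).
  by apply/measurable_EFinP; exact: measurable_exponential_density.
- by move=> t _; rewrite mule_ge0// lee_fin mulr_ge0 ?expR_ge0// ltW.
- by rewrite lee_fin stacy_pdf_ge0.
rewrite [RHS]integral_mul_indic; apply: eq_integral => t _.
rewrite indicE half_lineE; case: ltP => t0; last first.
  by rewrite mule0 exp_stacy1_pdf_eq0 ?mule0// (ltNge 0%R t) t0.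
by rewrite mule1 exp_stacy1_pdfE// EFinM muleCA.
Qed.

Context d (T : measurableType d) (P : probability T R).

Section conditionally_exponential.
Variables (xi tau : {RV P >-> R}).
Hypothesis hxi : is_stacy P xi alpha beta c.
Variable kappa : R.-pker R ~> R.
Hypothesis hkappa : cond_distribution tau xi kappa.
Hypothesis hexp : forall l : R, (0 < l)%R -> forall A : set R, measurable A ->
  kappa l A = exponential_prob l A.

(** On a rectangle, the joint probability is the integral of the conditional one
against the Stacy density; this is the iterated integral of the joint density. *)
Lemma conditionally_exponential_joint :
  is_exp_stacy1 P (fun w => (tau w, xi w)) alpha beta c.
Proof.
apply: density_of_rect => //.
- exact: (measurable_funP tau).
- exact: (measurable_funP xi).
move=> A B mA mB.
rewrite setIC hkappa// integral_mkcond epatch_indic.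
have mk : measurable_fun [set: R] (fun x => kappa x A) by exact: measurable_kernel.
rewrite ge0_integral_distribution//; last 2 first.
- apply: emeasurable_funM => //.
  by apply/measurable_EFinP; exact: measurable_indic.
- by move=> x; rewrite mule_ge0// lee_fin.
rewrite (@ge0_integral_pushforward_density _ _ _ _ _ (measurableTypeR R) mu xi s
   (fun x => kappa x A * (\1_B x)%:E) (measurable_funP xi) hxi); last 2 first.
- by move=> x; rewrite mule_ge0// lee_fin.
- apply: emeasurable_funM => //.
  by apply/measurable_EFinP; exact: measurable_indic.
rewrite [RHS]integral_mul_indic; apply: eq_integral => x _.
rewrite muleAC; congr (_ * _).
have [x0|x0] := ltP 0%R x; last first.
  rewrite [s x]ifF ?ltNge ?x0// mule0 integral0_eq// => t _.
  by rewrite exp_stacy1_pdf_eq0// (ltNge _ x) x0 andbF.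
rewrite hexp// exponential_probE// muleC -ge0_integralZl//; last 3 first.
- apply/measurable_EFinP/measurable_funTS; apply: measurable_funM => //.
  exact: measurable_exponential_density.
- by move=> t _; rewrite lee_fin !mulr_ge0 ?expR_ge0// ltW.
- by rewrite lee_fin stacy_pdf_ge0.
rewrite [LHS]integral_mul_indic [RHS]integral_mul_indic.
apply: eq_integral => t _; rewrite !indicE half_lineE.
case: ltP => t0; last first.
  by rewrite mule0 exp_stacy1_pdf_eq0 ?mul0e// (ltNge 0%R t) t0.
by rewrite mule1 exp_stacy1_pdfE// -!EFinM; congr EFin; ring.
Qed.

End conditionally_exponential.
End joint_law.

Section exp_stacy_moments.
Local Open Scope ereal_scope.
Context {R : realType}.
Local Notation mu := (@lebesgue_measure R).
Local Notation RR := (measurableTypeR R * measurableTypeR R)%type.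
Variables alpha beta c : R.
Hypotheses (alpha0 : (0 < alpha)%R) (beta0 : (0 < beta)%R) (c0 : c != 0%R).
Local Notation s := (stacy_pdf alpha beta c).
Local Notation joint := (exp_stacy1_pdf alpha beta c).
Local Notation f := (exp_st_pdf alpha beta c).

Let joint_ge0 := exp_stacy1_pdf_ge0 alpha0 beta0 c0.
Let mjoint := measurable_exp_stacy1_pdf alpha beta c.
Let mjointE : measurable_fun [set: RR] (EFin \o joint).
Proof. exact/measurable_EFinP. Qed.

Lemma exp_st_pdf_ge0 t : (0 <= f t)%R.
Proof.
rewrite -lee_fin -integral_exp_stacy1_pdf//.
by apply: integral_ge0 => x _; rewrite lee_fin.
Qed.

Lemma exp_st_pdf_eq0 (t : R) : (t <= 0)%R -> f t = 0%R.
Proof. by move=> t0; rewrite /exp_st_pdf ltNge t0. Qed.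

Lemma measurable_exp_st_pdf : measurable_fun [set: R] f.
Proof.
apply/measurable_EFinP.
rewrite (_ : _ \o _ = fun t => \int[mu]_x (EFin \o joint) (t, x)).
  apply: (@measurable_fun_fubini_tonelli_F _ _ (measurableTypeR R)
    (measurableTypeR R) R mu (EFin \o joint)) => //.
by apply/funext => t /=; rewrite -integral_exp_stacy1_pdf.
Qed.

(** The iterated integral of t^z against the joint density: integrating in x first
gives the left-hand side; integrating in t first gives Gamma (z + 1) x^-z, which
is then integrated against the Stacy density. *)
Lemma exp_st_moment z :
  \int[mu]_(t in `]0%R, +oo[) (t `^ z * f t)%R%:E =
  Gamma (z + 1) * (beta `^ z / fine (Gamma alpha))%R%:E * Gamma (alpha - z / c).
Proof.
pose g (p : RR) : \bar R := (p.1 `^ z)%R%:E.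
have g0 p : 0 <= g p by rewrite lee_fin powR_ge0.
have mg : measurable_fun [set: RR] g.
  by apply/measurable_EFinP; apply: (measurableT_comp (measurable_powR z)).
transitivity (\int[mu \x mu]_p (g p * (joint p)%:E)).
  rewrite fubini_tonelli1//; last 2 first.
  - by apply: emeasurable_funM => //; exact/measurable_EFinP.
  - by move=> p; rewrite mule_ge0// lee_fin.
  rewrite [LHS]integral_mul_indic; apply: eq_integral => t _; rewrite /fubini_F.
  rewrite [RHS](_ : _ =
    \int[mu]_x ((t `^ z)%R%:E * (EFin \o joint) (t, x)))// ge0_integralZl//;
    last 3 first.
  - by apply: (measurableT_comp mjointE).
  - by move=> x _; rewrite lee_fin.
  - by rewrite lee_fin powR_ge0.
  rewrite integral_exp_stacy1_pdf// indicE half_lineE.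
  by case: ltP => t0; rewrite ?mule1// exp_st_pdf_eq0// mulr0 !mule0.
rewrite ge0_integral_exp_stacy1// -muleA -stacy_moment// muleC -ge0_integralZr//; last 3 first.
- apply: measurable_funTS; apply: emeasurable_funM; apply/measurable_EFinP => //.
  exact: measurable_stacy_pdf.
- by move=> x _; rewrite mule_ge0// lee_fin ?powR_ge0 ?stacy_pdf_ge0.
- exact/ltW/Gamma_gt0.
apply: eq_integral_half_line => x x0; rewrite -muleA; congr (_ * _).
by rewrite -exponential_moment.
Qed.

End exp_stacy_moments.

Section consequences.
Local Open Scope ereal_scope.
Context {R : realType}.
Local Notation mu := (@lebesgue_measure R).
Local Notation RR := (measurableTypeR R * measurableTypeR R)%type.
Context d (T : measurableType d) (P : probability T R).

Variables alpha beta c : R.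
Hypotheses (alpha0 : (0 < alpha)%R) (beta0 : (0 < beta)%R) (c0 : c != 0%R).
Variables (xi tau : {RV P >-> R}).
Hypothesis hxi : is_stacy P xi alpha beta c.
Hypothesis hjoint : is_exp_stacy1 P (fun w => (tau w, xi w)) alpha beta c.
Local Notation s := (stacy_pdf alpha beta c).
Local Notation joint := (exp_stacy1_pdf alpha beta c).
Local Notation f := (exp_st_pdf alpha beta c).

Let joint_ge0 := exp_stacy1_pdf_ge0 alpha0 beta0 c0.
Let mjoint := measurable_exp_stacy1_pdf alpha beta c.
Let mjointE : measurable_fun [set: RR] (EFin \o joint).
Proof. exact/measurable_EFinP. Qed.

Let mxi : measurable_fun [set: T] (xi : T -> measurableTypeR R).
Proof. exact: (measurable_funP xi). Qed.

Let mtau : measurable_fun [set: T] (tau : T -> measurableTypeR R).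
Proof. exact: (measurable_funP tau). Qed.

(** Integrate the joint density in x. *)
Lemma exp_stacy1_marginal : is_exp_st P tau alpha beta c.
Proof.
split; [exact: exp_st_pdf_ge0|exact: measurable_exp_st_pdf|].
move=> A mA.
rewrite -[LHS]/(P (tau @^-1` A)) -[tau @^-1` A]setIT -(preimage_setT xi).
rewrite (probability_rect_density hjoint)//.
by apply: eq_integral => t _; rewrite integral_exp_stacy1_pdf.
Qed.

Lemma ge0_expectation_exp_stacy1 (g : RR -> \bar R) :
  (forall p, 0 <= g p) -> measurable_fun [set: RR] g ->
  \int[P]_w g (tau w, xi w) =
  \int[mu]_(x in `]0%R, +oo[) ((s x)%:E *
    \int[mu]_(t in `]0%R, +oo[) (g (t, x) * (x * expR (- (t * x)))%R%:E)).
Proof.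
move=> g0 mg; rewrite -ge0_integral_exp_stacy1//.
have mtx : measurable_fun [set: T] (fun w => (tau w, xi w) : RR).
  exact: measurable_fun_pair.
exact: (ge0_integral_pushforward_density mtx hjoint g0 mg).
Qed.

Let mscale_preimage (x : R) (B : set R) : measurable B ->
  measurable ((fun t : R => t * x)%R @^-1` B).
Proof.
move=> mB; have mx : measurable_fun [set: R] (fun t : R => t * x)%R.
  exact: measurable_funM.
by rewrite -[X in measurable X]setTI; exact: mx.
Qed.

(** The variable is tau * xi: given xi = x it has the law of x times an exponential
variable of rate x, which is Exp(1) whatever x. *)
Lemma exp_stacy1_product : exists eta : {RV P >-> R},
  is_exp P eta 1 /\ independent_RV P xi eta.
Proof.
have mprod : measurable_fun [set: T] (fun w => tau w * xi w)%R.
  exact: measurable_funM.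
pose eta : {RV P >-> R} := HB.pack_for {RV P >-> R} (fun w => tau w * xi w)%R
  (isMeasurableFun.Build _ _ _ _ _ mprod).
have indep A B : measurable A -> measurable B ->
    P (xi @^-1` A `&` eta @^-1` B) = P (xi @^-1` A) * exponential_prob 1 B.
  move=> mA mB.
  have mxiA : measurable (xi @^-1` A) by exact: measurable_funPTI.
  have metaB : measurable (eta @^-1` B) by exact: measurable_funPTI.
  pose g (p : RR) : \bar R := (\1_A p.2 * \1_B (p.1 * p.2))%R%:E.
  have g0 p : 0 <= g p by rewrite lee_fin mulr_ge0.
  have mg : measurable_fun [set: RR] g.
    apply/measurable_EFinP; apply: measurable_funM.
      have mA' : measurable_fun [set: R] (\1_A : R -> R) by exact: measurable_indic.
      by apply: (measurableT_comp mA').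
    have mB' : measurable_fun [set: R] (\1_B : R -> R) by exact: measurable_indic.
    by apply: (measurableT_comp mB'); exact: measurable_funM.
  transitivity (\int[P]_w g (tau w, xi w)).
    rewrite -[X in P X = _]setIT -integral_indic//; last exact: measurableI.
    by apply: eq_integral => w _; rewrite /g indicI.
  have inner (x : R) : (0 < x)%R ->
      \int[mu]_(t in `]0%R, +oo[) (g (t, x) * (x * expR (- (t * x)))%R%:E) =
      (\1_A x)%:E * exponential_prob 1 B.
    move=> x0; rewrite -(exponential_prob_scale x0 mB) exponential_probE;
      last exact: mscale_preimage.
    rewrite -ge0_integralZl//; last 2 first.
    - apply/measurable_EFinP/measurable_funTS.
      apply: measurable_funM; last exact: measurable_exponential_density.
      by apply: measurable_indic; exact: mscale_preimage.
    - by move=> t _; rewrite lee_fin !mulr_ge0 ?expR_ge0// ltW.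
    by apply: eq_integral_half_line => t t0; rewrite /g -!EFinM -mulrA.
  rewrite ge0_expectation_exp_stacy1//.
  transitivity (\int[mu]_(x in `]0%R, +oo[) (((\1_A x)%:E * (s x)%:E) * exponential_prob 1 B)).
    apply: eq_integral_half_line => x x0.
    by rewrite inner// muleA [in RHS](muleC (\1_A x)%:E).
  rewrite ge0_integralZr//; last 3 first.
  - apply: measurable_funTS; apply: emeasurable_funM; apply/measurable_EFinP.
      exact: measurable_indic.
    exact: measurable_stacy_pdf.
  - by move=> x _; rewrite mule_ge0// lee_fin stacy_pdf_ge0.
  - by apply: integral_ge0 => x _; rewrite lee_fin exponential_pdf_ge0.
  congr (_ * _); rewrite -[RHS]/(pushforward P xi A).
  case: hxi => _ _ ->//.
  rewrite [LHS]integral_mul_indic [RHS]integral_mul_indic.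
  apply: eq_integral => x _; rewrite !indicE half_lineE.
  have [x0|x0] := ltP 0%R x; first by rewrite mule1 muleC.
  by rewrite [s x]ifF ?ltNge ?x0// !mule0 mul0e.
exists eta; split => [A mA|A B mA mB].
  rewrite -[LHS]/(P (eta @^-1` A)) -[eta @^-1` A]setTI -(preimage_setT xi).
  by rewrite indep// preimage_setT probability_setT mul1e.
rewrite indep//; congr (_ * _).
rewrite -[eta @^-1` B]setTI -(preimage_setT xi).
by rewrite indep// preimage_setT probability_setT mul1e.
Qed.

(** Independence gives (xi, eta) a product density; for fixed x the scaling
y = t x carries the section of an event for the pair (y / x, x) to its section
for (t, x), and Exp(1) to the exponential law of rate x. *)
Lemma exp_stacy1_quotient (eta : {RV P >-> R}) :
  is_exp P eta 1 -> independent_RV P xi eta ->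
  is_exp_stacy1 P (fun w => (eta w / xi w, xi w)%R) alpha beta c.
Proof.
move=> eta1 xieta.
have meta : measurable_fun [set: T] (eta : T -> measurableTypeR R).
  exact: (measurable_funP eta).
have etad : density_of mu (pushforward P eta) (exponential_pdf 1).
  by split; [move=> x; exact: exponential_pdf_ge0|
    exact: measurable_exponential_pdf|exact: eta1].
have [_ mj jE] := density_of_independent mxi meta hxi etad xieta.
split => // C mC.
have mD : measurable [set p : R * R | C (p.2 / p.1, p.1)%R].
  have mq : measurable_fun [set: RR] (fun p : RR => (p.2 / p.1, p.1)%R : RR).
    apply: measurable_fun_pair => //; apply: measurable_funM => //.
    by apply: (measurableT_comp measurable_funV).
  by rewrite -[X in measurable X]setTI; exact: mq.
rewrite -[LHS]/(P ((fun w => (xi w, eta w)) @^-1` [set p | C (p.2 / p.1, p.1)%R])).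
rewrite [LHS]jE//.
rewrite [LHS]integral_mkcond epatch_indic fubini_tonelli1; last 2 first.
- apply: emeasurable_funM; first exact/measurable_EFinP.
  by apply/measurable_EFinP; exact: measurable_indic.
- by move=> p; rewrite mule_ge0// lee_fin// mulr_ge0 ?stacy_pdf_ge0// exponential_pdf_ge0.
rewrite [RHS]integral_mkcond epatch_indic.
transitivity (\int[mu \x mu]_p ((\1_C p)%:E * (joint p)%:E)); last first.
  by apply: eq_integral => p _; rewrite /= muleC.
rewrite [RHS](@ge0_integral_exp_stacy1 _ _ _ _ _ _ _ (fun p => (\1_C p)%:E))//; last first.
  by apply/measurable_EFinP; exact: measurable_indic.
rewrite [RHS]integral_mul_indic; apply: eq_integral => x _; rewrite /fubini_F.
rewrite indicE half_lineE; have [x0|x0] := ltP 0%R x; last first.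
  rewrite mule0 integral0_eq// => y _ /=.
  by rewrite [s x]ifF ?ltNge ?x0// mul0r mul0e.
rewrite mule1.
pose B := [set y : R | C (y / x, x)%R].
have mB : measurable B.
  have mq : measurable_fun [set: measurableTypeR R]
      (fun y : measurableTypeR R => (y / x, x)%R : RR).
    by apply: measurable_fun_pair => //; exact: measurable_funM.
  by rewrite -[X in measurable X]setTI; exact: mq.
transitivity ((s x)%:E * exponential_prob 1 B).
  rewrite /exponential_prob [in RHS]integral_mul_indic -ge0_integralZl//; last 3 first.
  - apply: emeasurable_funM; apply/measurable_EFinP.
      exact: measurable_exponential_pdf.
    exact: measurable_indic.
  - by move=> y _; rewrite mule_ge0// lee_fin exponential_pdf_ge0.
  - by rewrite lee_fin stacy_pdf_ge0.
  by apply: eq_integral => y _ /=; rewrite EFinM muleA.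
rewrite -(exponential_prob_scale x0 mB) exponential_probE;
  last exact: mscale_preimage.
congr (_ * _); apply: eq_integral_half_line => t t0.
rewrite -EFinM; congr (_ * _)%:E.
rewrite !indicE; congr (nat_of_bool _)%:R.
by apply/idP/idP; rewrite !inE /B/= mulfK ?gt_eqF.
Qed.

End consequences.

(** * The conditional law given the observation time *)

Section conditional_density.
Local Open Scope ereal_scope.
Context {R : realType}.
Local Notation mu := (@lebesgue_measure R).
Context d (T : measurableType d) (P : probability T R).
Variables alpha beta c : R.
Hypotheses (alpha0 : (0 < alpha)%R) (beta0 : (0 < beta)%R) (c0 : c != 0%R).
Local Notation s := (stacy_pdf alpha beta c).
Local Notation joint := (exp_stacy1_pdf alpha beta c).
Local Notation f := (exp_st_pdf alpha beta c).
Local Notation K := (`|c| * (beta `^ (c * alpha) / fine (Gamma alpha)))%R.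

Lemma stacy_cond_pdfE (t x : R) : (0 < t)%R ->
  stacy_cond_pdf alpha beta c t x = (joint (t, x) / f t)%R.
Proof.
move=> t0; rewrite /stacy_cond_pdf; case: ifPn => x0; last first.
  by rewrite exp_stacy1_pdf_eq0 ?mul0r// (negbTE x0) andbF.
rewrite exp_stacy1_pdfE2// exp_st_pdfE// (kratzelE c beta0 (c * alpha) t0).
have Gn : fine (Gamma alpha) != 0%R by rewrite gt_eqF// fine_Gamma_gt0.
have bc : (beta `^ (c * alpha))%R != 0%R by rewrite gt_eqF// powR_gt0.
have cn : `|c|%R != 0%R by rewrite normr_eq0.
have b0 : (beta `^ (c * alpha + 1))%R != 0%R by rewrite gt_eqF// powR_gt0.
have S0 : fine (stretched_laplace beta c (c * alpha) t) != 0%R.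
  by rewrite -eqe fineK_stretched_laplace// gt_eqF// stretched_laplace_gt0.
by field; rewrite Gn S0 bc cn b0.
Qed.

Lemma mean_stacy_cond (t : R) : (0 < t)%R ->
  \int[mu]_(x in `]0%R, +oo[) (x * stacy_cond_pdf alpha beta c t x)%R%:E =
  (kratzel (- c) (- (c * alpha) - 2) (t / beta) /
    (beta * kratzel (- c) (- (c * alpha) - 1) (t / beta)))%R%:E.
Proof.
move=> t0.
rewrite (_ : - (c * alpha) - 2 = - (c * alpha + 1) - 1)%R; last by ring.
rewrite !(kratzelE c beta0 _ t0).
have S0 : fine (stretched_laplace beta c (c * alpha) t) != 0%R.
  by rewrite -eqe fineK_stretched_laplace// gt_eqF// stretched_laplace_gt0.
have S1fin : stretched_laplace beta c (c * alpha + 1) t \is a fin_num.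
  by rewrite gt0_fin_numE ?stretched_laplace_gt0// stretched_laplace_lty.
have b1 : (beta `^ (c * alpha + 1))%R != 0%R by rewrite gt_eqF// powR_gt0.
transitivity ((fine (stretched_laplace beta c (c * alpha) t))^-1%:E *
    stretched_laplace beta c (c * alpha + 1) t); last first.
  rewrite -(fineK S1fin) -EFinM; congr EFin.
  rewrite (@powRD _ beta (c * alpha + 1) 1) ?(gt_eqF beta0) ?implybT// powRr1 ?ltW//.
  by field; rewrite S0 b1 gt_eqF.
rewrite -ge0_integralZl//; last 3 first.
- exact: measurable_stretched.
- by move=> x _; rewrite lee_fin mulr_ge0 ?powR_ge0 ?expR_ge0.
- by rewrite lee_fin invr_ge0 fine_ge0// ltW// stretched_laplace_gt0.
apply: eq_integral_half_line => x x0; rewrite -EFinM; congr EFin.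
rewrite stacy_cond_pdfE// exp_stacy1_pdfE2// exp_st_pdfE//.
rewrite (@powRD _ x (c * alpha) 1) ?(gt_eqF x0) ?implybT// powRr1 ?ltW//.
have Gn : fine (Gamma alpha) != 0%R by rewrite gt_eqF// fine_Gamma_gt0.
have bc : (beta `^ (c * alpha))%R != 0%R by rewrite gt_eqF// powR_gt0.
have cn : `|c|%R != 0%R by rewrite normr_eq0.
by field; rewrite Gn S0 bc cn.
Qed.

Variables (xi tau : {RV P >-> R}).
Hypothesis hxi : is_stacy P xi alpha beta c.
Hypothesis hjoint : is_exp_stacy1 P (fun w => (tau w, xi w)) alpha beta c.

(** The conditional density is the quotient of the joint density by the positive
marginal density.  For t <= 0, a null event, the Stacy density makes the
kernel a probability kernel. *)
Lemma exp_stacy1_conditional : exists kappa : R.-pker R ~> R,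
  [/\ cond_distribution xi tau kappa,
      forall t : R, (0 < t)%R -> density_of mu (kappa t) (stacy_cond_pdf alpha beta c t) &
      forall t : R, (0 < t)%R -> cond_expectation kappa t =
        (kratzel (- c) (- (c * alpha) - 2) (t / beta) /
          (beta * kratzel (- c) (- (c * alpha) - 1) (t / beta)))%R%:E].
Proof.
pose h (p : R * measurableTypeR R) : R :=
  if (0 < p.1)%R then (joint p / f p.1)%R else s p.2.
have joint_ge0 := exp_stacy1_pdf_ge0 alpha0 beta0 c0.
have f_ge0 := exp_st_pdf_ge0 alpha0 beta0 c0.
have mf := measurable_exp_st_pdf alpha0 beta0 c0.
have mjoint := measurable_exp_stacy1_pdf alpha beta c.
have h0 p : (0 <= h p)%R.
  by rewrite /h; case: ifP => _; [rewrite divr_ge0|rewrite stacy_pdf_ge0].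
have mh : measurable_fun [set: R * measurableTypeR R] h.
  apply: measurable_fun_ifT => //; first exact: measurable_fun_ltr.
    apply: measurable_funM => //.
    apply: (measurableT_comp measurable_funV).
    by apply: (measurableT_comp mf).
  by apply: (measurableT_comp (measurable_stacy_pdf alpha beta c)).
have hp t x : (0 < t)%R -> h (t, x) = (joint (t, x) / f t)%R.
  by move=> t0; rewrite /h/= t0.
have hn t x : (t <= 0)%R -> h (t, x) = s x.
  by move=> t0; rewrite /h/= ltNge t0.
have h1 t : \int[mu]_x (h (t, x))%:E = 1.
  (* the Stacy density has total mass 1, being the density of xi *)
  have [t0|t0] := ltP 0%R t; last first.
    under eq_integral do rewrite hn//.
    case: hxi => _ _ /(_ setT measurableT) <-.
    by rewrite /pushforward preimage_setT probability_setT.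
  have ft0 := exp_st_pdf_gt0 alpha0 beta0 c0 t0.
  have mjt : measurable_fun [set: measurableTypeR R]
      (fun x : measurableTypeR R => joint (t : measurableTypeR R, x)).
    by apply: (measurableT_comp mjoint).
  under eq_integral do rewrite hp// EFinM.
  rewrite ge0_integralZr//; last 3 first.
  - exact/measurable_EFinP.
  - by move=> x _; rewrite lee_fin.
  - by rewrite lee_fin invr_ge0.
  by rewrite integral_exp_stacy1_pdf// -EFinM mulfV// gt_eqF.
have [kappa kE] := density_pker h0 mh h1.
have kcond t : (0 < t)%R -> density_of mu (kappa t) (stacy_cond_pdf alpha beta c t).
  move=> t0.
  have hE : (fun x => h (t, x)) = stacy_cond_pdf alpha beta c t.
    by apply/funext => x; rewrite stacy_cond_pdfE// hp.
  rewrite -hE; split; [by move=> x; exact: h0| |by move=> A mA; exact: kE].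
  by apply: (measurableT_comp mh).
exists kappa; split => //.
- move=> A B mA mB.
  rewrite (probability_rect_density hjoint)// [RHS]integral_mkcond epatch_indic.
  have mk : measurable_fun [set: R] (fun t => kappa t B) by exact: measurable_kernel.
  have mg : measurable_fun [set: R] (fun t => kappa t B * (\1_A t)%:E).
    by apply: emeasurable_funM => //; apply/measurable_EFinP; exact: measurable_indic.
  have g0 t : 0 <= kappa t B * (\1_A t)%:E by rewrite mule_ge0// lee_fin.
  rewrite [RHS]ge0_integral_distribution//.
  have [_ _ taud] := exp_stacy1_marginal alpha0 beta0 c0 hjoint.
  rewrite [RHS](@ge0_integral_pushforward_density _ _ _ _ _ (measurableTypeR R) mu tau f
    _ (measurable_funP tau) (exp_stacy1_marginal alpha0 beta0 c0 hjoint) g0 mg).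
  rewrite [LHS]integral_mul_indic; apply: eq_integral => t _.
  rewrite muleAC; congr (_ * _).
  have [t0|t0] := ltP 0%R t; last first.
    rewrite exp_st_pdf_eq0// mule0 integral0_eq// => x _.
    by rewrite exp_stacy1_pdf_eq0// (ltNge _ t) t0.
  rewrite kE -ge0_integralZr//; last 3 first.
  - by apply/measurable_EFinP/measurable_funTS; apply: (measurableT_comp mh).
  - by move=> x _; rewrite lee_fin.
  - by rewrite lee_fin.
  apply: eq_integral => x _; rewrite hp// -EFinM divfK//.
  by rewrite gt_eqF// exp_st_pdf_gt0.
- move=> t t0; rewrite -mean_stacy_cond// /cond_expectation.
  rewrite (@integral_id_density _ _ _ (kappa t) id (stacy_cond_pdf alpha beta c t))//.
    exact: kcond.
  by move=> x x0; rewrite /stacy_cond_pdf ltNge ltW.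
Qed.

End conditional_density.

(** * Variance of the Exp-Stacy law *)

Section exp_st_variance.
Local Open Scope ereal_scope.
Context {R : realType}.
Local Notation mu := (@lebesgue_measure R).
Context d (T : measurableType d) (P : probability T R).

Variables alpha beta c : R.
Hypotheses (alpha0 : (0 < alpha)%R) (beta0 : (0 < beta)%R) (c0 : c != 0%R).

(** The hypothesis makes 1 / c strictly less than alpha whatever the sign of c, so
the mean is finite; the second moment is infinite when 2 / c = alpha. *)
Lemma variance_exp_st (tau : {RV P >-> R}) : is_exp_st P tau alpha beta c ->
  (Num.max (2 / c) (1 / c) <= alpha)%R ->
  'V_P[tau] = (beta ^+ 2 / fine (Gamma alpha))%R%:E *
    (2%:E * Gamma (alpha - 2 / c) -
     ((fine (Gamma alpha))^-1)%R%:E * Gamma (alpha - 1 / c) ^+ 2).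
Proof.
move=> tauf; rewrite ge_max => /andP[c2 c1].
have c1' : (1 / c < alpha)%R.
  have [cp|cn] := ltP 0%R c.
    rewrite (lt_le_trans _ c2)// ltr_pM2r ?invr_gt0//.
    by rewrite ltr1n.
  by rewrite (le_lt_trans _ alpha0)// div1r invr_le0.
have e3 : (3 = 2 + 1 :> R)%R by ring.
have G2 : Gamma 2 = 1 :> \bar R.
  by rewrite (_ : 2 = 1 + 1)%R// GammaS// Gamma1 mule1.
have G3 : Gamma 3 = 2%:E :> \bar R.
  by rewrite e3 GammaS// G2 mule1.
have G1fin : Gamma (alpha - 1 / c) \is a fin_num.
  by rewrite gt0_fin_numE ?Gamma_gt0// Gamma_lty// subr_gt0.
have m1 : \int[lebesgue_measure]_(y in `]0%R, +oo[) (y * exp_st_pdf alpha beta c y)%R%:E =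
    (beta / fine (Gamma alpha) * fine (Gamma (alpha - 1 / c)))%R%:E.
  rewrite EFinM fineK// -[RHS]mul1e -G2 (_ : 2 = 1 + 1)%R// muleA.
  rewrite -[in RHS](powRr1 (ltW beta0)) -exp_st_moment//.
  by apply: eq_integral_half_line => y y0; rewrite powRr1// ltW.
have m2 : \int[lebesgue_measure]_(y in `]0%R, +oo[) (y ^+ 2 * exp_st_pdf alpha beta c y)%R%:E =
    2%:E * (beta ^+ 2 / fine (Gamma alpha))%R%:E * Gamma (alpha - 2 / c).
  rewrite -G3 e3.
  rewrite -(powR_mulrn 2 (ltW beta0)) -exp_st_moment//.
  by apply: eq_integral_half_line => y y0; rewrite powR_mulrn// ltW.
rewrite (variance_density (measurable_funP tau) tauf); last 2 first.
- by move=> x x0; exact: exp_st_pdf_eq0.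
- by rewrite m1 ltry.
rewrite m1 m2.
have Gp := fine_Gamma_gt0 alpha0.
have k0 : (0 < beta ^+ 2 / fine (Gamma alpha))%R by rewrite divr_gt0 ?exprn_gt0.
rewrite -[in RHS](fineK G1fin).
have := @Gamma_gt0 R (alpha - 2 / c).
(* in the infinite case both sides are +oo *)
case: (Gamma (alpha - 2 / c)) => [r _| _|//].
  rewrite -!EFin_expe -!EFinM -!EFinB -?EFinM; congr EFin.
  by field; rewrite gt_eqF.
have two : 2%:E * +oo = +oo :> \bar R by rewrite gt0_muley// lte_fin.
rewrite -!EFin_expe -!EFinM two [X in X - _]gt0_muley; last first.
  by rewrite lte_fin mulr_gt0.
by rewrite /= gt0_muley// lte_fin.
Qed.

End exp_st_variance.

(** * Properties of the Exp-Stacy law *)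

Unset Implicit Arguments.

Theorem theorem1 (R : realType) (d : measure_display) (T : measurableType d)
    (P : probability T R) (alpha beta c : R)
    (halpha : 0 < alpha) (hbeta : 0 < beta) (hc : c != 0)
    (xi tau : {RV P >-> R}) (hxi : is_stacy P xi alpha beta c)
    (kappa : R.-pker R ~> R) (hkappa : cond_distribution tau xi kappa)
    (hexp : forall lambda : R, 0 < lambda -> forall A : set R, measurable A ->
       kappa lambda A = exponential_prob lambda A) :
  (* a *)
  is_exp_st P tau alpha beta c /\
  (* b *)
  (forall k : R, 0 < k ->
     is_exp_st P (fun w => k * tau w) alpha (k * beta) c) /\
  (* c *)
  ((exists eta : {RV P >-> R}, is_exp P eta 1 /\ independent_RV P xi eta) /\
   (forall eta : {RV P >-> R}, is_exp P eta 1 -> independent_RV P xi eta ->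
     eq_dist P tau (fun w => eta w / xi w))) /\
  (* d *)
  ((forall z : R, -1 <= z -> z / c <= alpha ->
     ('E_P[(fun w => tau w `^ z)%R] =
        Gamma (z + 1) * (beta `^ z / fine (Gamma alpha))%:E *
          Gamma (alpha - z / c))%E) /\
   (Num.max (2 / c) (1 / c) <= alpha ->
     ('V_P[tau] =
        (beta ^+ 2 / fine (Gamma alpha))%:E *
          (2%:E * Gamma (alpha - 2 / c) -
           ((fine (Gamma alpha))^-1)%:E * Gamma (alpha - 1 / c) ^+ 2))%E)) /\
  (* e *)
  (is_exp_stacy1 P (fun w => (tau w, xi w)) alpha beta c /\
   (forall eta : {RV P >-> R}, is_exp P eta 1 -> independent_RV P xi eta ->
     eq_dist P (fun w => (tau w, xi w)) (fun w => (eta w / xi w, xi w)))) /\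
  (* g *)
  (forall x : R, 0 < x -> cond_expectation kappa x = (x^-1)%:E) /\
  (* f and h *)
  (exists kappa' : R.-pker R ~> R,
     [/\ cond_distribution xi tau kappa',
         forall t : R, 0 < t ->
           density_of (@lebesgue_measure R) (kappa' t)
             (stacy_cond_pdf alpha beta c t) &
         forall t : R, 0 < t ->
           cond_expectation kappa' t =
             (kratzel (- c) (- (c * alpha) - 2) (t / beta) /
               (beta * kratzel (- c) (- (c * alpha) - 1) (t / beta)))%:E]).
Proof.
have joint := conditionally_exponential_joint halpha hbeta hc hxi hkappa hexp.
have marginal := exp_stacy1_marginal halpha hbeta hc joint.
have quotient (eta : {RV P >-> R}) : is_exp P eta 1 -> independent_RV P xi eta ->
    eq_dist P (fun w => (tau w, xi w)) (fun w => (eta w / xi w, xi w)).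
  move=> eta1 xieta A mA.
  have [_ _ jE] := joint.
  have [_ _ qE] := exp_stacy1_quotient halpha hbeta hc hxi eta1 xieta.
  by rewrite [LHS]jE// [RHS]qE.
split; first exact: marginal.
split.
  move=> k k0.
  have := density_of_scale k0 marginal.
  rewrite (_ : (fun x => _ / k) = exp_st_pdf alpha (k * beta) c)//.
  apply/funext => x; rewrite /exp_st_pdf pmulr_lgt0 ?invr_gt0//.
  case: ifPn => x0; last by rewrite mul0r.
  rewrite (_ : x / k / beta = x / (k * beta)); last by rewrite invfM mulrA.
  have G0 : fine (Gamma alpha) != 0 by rewrite gt_eqF// fine_Gamma_gt0.
  by field; rewrite G0 !gt_eqF.
split.
  split; first exact: (exp_stacy1_product halpha hbeta hc hxi joint).
  move=> eta eta1 xieta A mA.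
  have E (Z : T -> R) : (fun w => (Z w, xi w)) @^-1` (A `*` setT) = Z @^-1` A.
    by apply/seteqP; split => w //= [].
  have := quotient eta eta1 xieta (A `*` setT) (measurableX mA measurableT).
  by rewrite /pushforward !E.
split.
  split; last exact: variance_exp_st.
  move=> z _ _; rewrite unlock -exp_st_moment//.
  apply: (ge0_integral_half_line_density (measurable_funP tau) marginal).
  - by move=> t; exact: exp_st_pdf_eq0.
  - exact: measurable_powR.
  - by move=> t; exact: powR_ge0.
split; first by split; [exact: joint|exact: quotient].
split.
  move=> x x0; rewrite -exponential_mean// /cond_expectation.
  rewrite (@integral_id_density _ _ _ (kappa x) id (exponential_pdf x))//.
  - apply: eq_integral_half_line => y y0; congr (_ * _)%:E.
    by rewrite exponential_pdfE ?ltW// mulNr [x * y]mulrC.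
  - split; [by move=> y; exact: exponential_pdf_ge0 (ltW x0) _|
      exact: measurable_exponential_pdf|].
    by move=> A mA; exact: hexp.
  - by move=> y y0; exact: lt0_exponential_pdf.
exact: (exp_stacy1_conditional halpha hbeta hc hxi joint).
Qed.
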